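(* Let $T>0$, let $F \in C^{2,\beta}_{loc}(\mathbb{R})$ for some $\beta>0$ with $F\ge 0$, and let $\varepsilon>0$ be given. Let $u \in C^{2,1}_{loc}(\mathbb{R}^n\times[0,T])\cap L^\infty(\mathbb{R}^n\times(-\varepsilon,T])$ be a classical solution in $\mathbb{R}^n\times[0,T]$ of $$(1+|Du|^2)^{1/2}\left\{\operatorname{div}\left(\frac{Du}{(1+|Du|^2)^{1/2}}\right)-F'(u)\right\}=u_t,$$ such that $|Du|\le C$ for some constant $C$. If $u$ satisfies $$\frac{(1+|Du|^2)^{1/2}-1}{(1+|Du|^2)^{1/2}}\le F(u)$$ at $t=0$ (for all $x\in\mathbb{R}^n$), then $u$ satisfies this same inequality for all $x\in\mathbb{R}^n$ and all $t\in(0,T]$.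
   Context: $Du$ and $\operatorname{div}$ denote the gradient and divergence with respect to the space variable $x\in\mathbb{R}^n$ only; $u_t$ is the time derivative. The notation $u\in C^{2,1}_{loc}$ means that $u=u(x,t)$ has continuous derivatives of up to order two in the $x$ variable and up to order one in the $t$ variable. *)

(* Defs.v *)
From HB Require Import structures.
From mathcomp Require Import all_boot all_order all_algebra.
From mathcomp Require Import all_classical all_reals all_analysis.

Set Implicit Arguments.
Unset Strict Implicit.
Unset Printing Implicit Defensive.

Import Order.TTheory GRing.Theory Num.Theory.
Import numFieldNormedType.Exports.

Local Open Scope ring_scope.
Local Open Scope classical_set_scope.

Section SpaceCalculus.
Context {R : realType} {n : nat}.
Implicit Types (f : 'rV[R]_n -> R) (x v : 'rV[R]_n) (i j : 'I_n).

(* The library norm on 'rV[R]_n is the sup norm, so the Euclidean norm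
   has to be introduced separately. *)
Definition enorm v : R := Num.sqrt (\sum_i v 0 i ^+ 2).

Definition pderiv i f x : R := 'D_(delta_mx 0 i) f x.

Definition pderivable i f x : Prop := derivable f x (delta_mx 0 i).

Definition grad f x : 'rV[R]_n := \row_i pderiv i f x.

Definition divergence (V : 'rV[R]_n -> 'rV[R]_n) x : R :=
  \sum_i pderiv i (fun y => V y 0 i) x.

Definition slope f x : R := Num.sqrt (1 + enorm (grad f x) ^+ 2).

Definition mean_curvature f x : R :=
  divergence (fun y => (slope f y)^-1 *: grad f y) x.

End SpaceCalculus.

(* Functions of space-time are curried, u x t, and total; the time interval
   that matters is always passed explicitly. *)
Section SpaceTime.
Context {R : realType} {n : nat}.
Implicit Types (T : R) (u : 'rV[R]_n -> R -> R) (x : 'rV[R]_n) (t : R).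

(* Time derivative relative to [0, T]: one-sided at t = 0 and t = T. *)
Definition time_quotient T u x t : set_system R :=
  (fun s => (u x s - u x t) / (s - t)) @ within `[0, T] t^'.

Definition time_derivable T u x t : Prop := cvg (time_quotient T u x t).

Definition time_deriv T u x t : R := lim (time_quotient T u x t).

Definition continuous_slab T u : Prop :=
  {within [set: 'rV[R]_n] `*` `[0, T],
     continuous (fun p : 'rV[R]_n * R => u p.1 p.2)}.

(* C^{2,1}_loc(R^n x [0, T]) *)
Definition C21 T u : Prop :=
  [/\ forall x t, 0 <= t <= T ->
        [/\ forall i, pderivable i (u^~ t) x,
            forall i j, pderivable j (pderiv i (u^~ t)) x
          & time_derivable T u x t],
      continuous_slab T u,
      forall i, continuous_slab T (fun x t => pderiv i (u^~ t) x),
      forall i j,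
        continuous_slab T (fun x t => pderiv j (pderiv i (u^~ t)) x)
    & continuous_slab T (time_deriv T u)].

(* C^{2,beta}_loc(R): the second derivative is beta-Hoelder on compact sets. *)
Definition C2_holder_loc (beta : R) (F : R -> R) : Prop :=
  [/\ forall r : R, derivable F r 1 /\ derivable (derive1 F) r 1,
      continuous (derive1n 2 F)
    & forall K : set R, compact K ->
        exists L : R, forall r s : R, K r -> K s ->
          `|derive1n 2 F r - derive1n 2 F s| <= L * `|r - s| `^ beta].

Definition box (a b : 'rV[R]_n * R) : set ('rV[R]_n * R) :=
  [set p : 'rV[R]_n * R |
    (forall i, a.1 0 i <= p.1 0 i <= b.1 0 i) /\ a.2 <= p.2 <= b.2].

(* Side lengths are truncated at 0, so that empty boxes have volume 0. *)
Definition box_volume (a b : 'rV[R]_n * R) : R :=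
  (\prod_i Num.max 0 (b.1 0 i - a.1 0 i)) * Num.max 0 (b.2 - a.2).

(* The (n+1)-dimensional Lebesgue outer measure; Lebesgue measurable sets are
   those satisfying Caratheodory's criterion for it. *)
Definition lebesgue_outer (A : set ('rV[R]_n * R)) : \bar R :=
  ereal_inf [set v | exists a b : nat -> 'rV[R]_n * R,
    A `<=` \bigcup_k box (a k) (b k) /\
    v = (\sum_(0 <= k <oo) (box_volume (a k) (b k))%:E)%E].

(* u belongs to L^oo(D): Lebesgue measurable on D and essentially bounded. *)
Definition Linfty (D : set ('rV[R]_n * R)) u : Prop :=
  (forall Y : set R, open Y ->
     lebesgue_outer.-caratheodory (D `&` [set p | Y (u p.1 p.2)])) /\
  (exists M : R, lebesgue_outer (D `&` [set p | M < `|u p.1 p.2|]) = 0%E).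

Definition classical_solution T (F : R -> R) u : Prop :=
  forall x t, 0 <= t <= T ->
    slope (u^~ t) x * (mean_curvature (u^~ t) x - derive1 F (u x t))
    = time_deriv T u x t.

End SpaceTime.

(* Main.v *)
Require Import Defs.
From mathcomp Require Import all_boot all_order all_algebra.
From mathcomp Require Import all_classical all_reals all_analysis.
From mathcomp Require Import measurable_realfun ring lra.

Set Implicit Arguments.
Unset Strict Implicit.
Unset Printing Implicit Defensive.

Import Order.TTheory GRing.Theory Num.Theory.
Import numFieldNormedType.Exports.

Local Open Scope ring_scope.
Local Open Scope classical_set_scope.

(** The inequality compares the graph of [u] with the one-dimensional stationary
    profile [q], which satisfies [1 - (1 + q'^2)^(-1/2) = F (q)]: it says that [u]
    is nowhere steeper than [q] is at the same height, i.e. that [q^-1 (u)] has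
    gradient at most 1.  Writing this as the Lipschitz bound
    [psi (u (x, t)) - psi (u (y, t)) <= |x - y|] with [psi = q^-1] allows a maximum
    principle that differentiates [u] only twice, so that no third derivatives
    and no interior regularity theory are needed.  Replacing [F] by [F + delta]
    keeps [psi] Lipschitz where [F] vanishes; [delta] tends to 0 at the end.

    The bound holds initially by integrating the gradient bound along segments
    ([profile_cot_gradient_le1], [lipschitz_of_gradient]).  Suppose that the
    two-point function [psi (u (x, t)) - psi (u (y, t)) - |x - y|] is positive
    somewhere.  Penalized by [kappa |x|^2] and [eta t] it attains its maximum
    ([two_point_attains_max]), since [u] is bounded: the bound is an essential one,
    but null sets have empty interior ([lebesgue_outer_box],
    [Linfty_slab_bounded]).  The maximum lies at a positive time and at points
    whose distance is bounded below.  There [D psi (u)] equals the unit vector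
    [e] along [x - y] at [y], and [e + 2 kappa x] at [x]
    ([two_point_first_order]).  The equation in nondivergence form has coefficient
    matrix [1 - Du (x) Du / v^2] ([slope_mean_curvature]).  Summing the second
    order condition over the rows of its square root, taken at [x] and at [y]
    simultaneously, reproduces both elliptic operators ([sum_sqrt_row]); the two
    families of directions differ essentially along [e] only, where [|x - y|] has
    no second derivative ([sum_sqrt_row_perp]).  The zeroth order terms vanish
    where [|D psi (u)| = 1], because [q] is stationary ([zeroth_order_bound]).
    Hence the spatial part of the flow contributes at most an error that tends to 0
    with [kappa] ([two_point_flow_le]), whereas the first order condition in time
    forces it to be at least [eta] ([time_max_ge]): a contradiction
    ([two_point_comparison]).  The Lipschitz bound gives back the gradient bound
    at every time ([gradient_of_lipschitz], [gradient_profile_cot_le1]). *)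

(** * Directional derivatives and calculus on lines *)

Section DirectionalCalculus.
Context {R : realType} {V : normedModType R}.
Implicit Types (f g : V -> R) (x v w : V).

Lemma is_deriveDf f g x v (a b : R) : is_derive x v f a -> is_derive x v g b ->
  is_derive x v (fun y => f y + g y) (a + b).
Proof. exact: is_deriveD. Qed.

Lemma is_deriveBf f g x v (a b : R) : is_derive x v f a -> is_derive x v g b ->
  is_derive x v (fun y => f y - g y) (a - b).
Proof. exact: is_deriveB. Qed.

Lemma is_deriveMf f g x v (a b : R) : is_derive x v f a -> is_derive x v g b ->
  is_derive x v (fun y => f y * g y) (f x * b + g x * a).
Proof. exact: is_deriveM. Qed.

Lemma is_derive_sumf n (f : 'I_n -> V -> R) x v (a : 'I_n -> R) :
  (forall i, is_derive x v (f i) (a i)) ->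
  is_derive x v (fun y => \sum_i f i y) (\sum_i a i).
Proof.
move=> h; have -> : (fun y => \sum_i f i y) = \sum_i f i.
  by apply/funext => y; rewrite fct_sumE.
exact: is_derive_sum.
Qed.

Lemma is_derive_line f x v (s a : R) : is_derive (s *: v + x) v f a ->
  is_derive s 1 (fun r : R => f (r *: v + x)) a.
Proof.
move=> [df <-]; suff E : (fun h : R => h^-1 *: (((fun r : R => f (r *: v + x)) \o shift s) (h *: 1) - f (s *: v + x))) =
   (fun h : R => h^-1 *: ((f \o shift (s *: v + x)) (h *: v) - f (s *: v + x))).
  by split; rewrite /derivable /derive/= E.
by apply/funext => h /=; rewrite [_ *: 1]mulr1 scalerDl addrA.
Qed.

Lemma derive_line0 f x v : 'D_v f x = 'D_1 (fun r : R => f (r *: v + x)) 0.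
Proof.
rewrite /derive.
suff -> : (fun h : R => h^-1 *: ((f \o shift x) (h *: v) - f x)) =
  (fun h : R => h^-1 *: (((fun r : R => f (r *: v + x)) \o shift 0) (h *: 1)
     - f (0 *: v + x))) by [].
by apply/funext => h /=; rewrite addr0 [_ *: 1]mulr1 scale0r add0r.
Qed.

Lemma is_derive_comp1 (g : R -> R) f x v (a b : R) :
  is_derive (f x) 1 g a -> is_derive x v f b ->
  is_derive x v (fun y => g (f y)) (a * b).
Proof.
move=> gd fd.
have fd0 : is_derive (0 : R) 1 (fun r : R => f (r *: v + x)) b.
  by apply: is_derive_line; rewrite scale0r add0r.
have := @is_derive1_comp _ g (fun r : R => f (r *: v + x)) 0 a b.
rewrite scale0r add0r => /(_ gd fd0) [d e]; split.
  by apply/(@derivable1P R V R^o (fun y => g (f y)) x v).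
rewrite -e; exact: derive_line0.
Qed.

End DirectionalCalculus.

Section DirectionSums.
Context {R : realType} {V : normedModType R}.
Implicit Types (f g : V -> R) (x v w : V).

Lemma is_derive_scale f x v (c a : R) : is_derive x v f a ->
  is_derive x (c *: v) f (c * a).
Proof.
move=> fd.
have fd0 : is_derive (c * 0 : R) 1 (fun r : R => f (r *: v + x)) a.
  by apply: is_derive_line; rewrite mulr0 scale0r add0r.
have cd : is_derive (0 : R) 1 (fun r : R => c * r) c.
  have := is_deriveMf (is_derive_cst c (0 : R) 1) (is_derive_id (0 : R) 1).
  by rewrite /cst mulr1 mulr0 addr0.
have [d e] := is_derive_comp1 fd0 cd.
have E : (fun r : R => f ((c * r) *: v + x)) = fun r => f (r *: (c *: v) + x).
  by apply/funext => r; rewrite scalerA mulrC.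
rewrite E in d e; split; first by apply/(@derivable1P R V R^o).
by rewrite mulrC -e derive_line0.
Qed.

Lemma segment_MVT f (df : V -> R) x v :
  (forall y, is_derive y v f (df y)) ->
  exists2 s : R, 0 <= s <= 1 & f (v + x) - f x = df (s *: v + x).
Proof.
move=> fd.
have gd (s : R) : is_derive s 1 (fun r : R => f (r *: v + x)) (df (s *: v + x)).
  by apply: is_derive_line; exact: fd.
have [|s s01] := @MVT R _ _ 0 1 ltr01 (fun s _ => gd s).
  apply: derivable_within_continuous => s _; exact: (@ex_derive _ _ _ _ _ _ _ (gd s)).
rewrite scale1r scale0r add0r subr0 mulr1 => ->; exists s => //.
by move: s01; rewrite in_itv/= => /andP[/ltW -> /ltW ->].
Qed.

(** The step that makes continuous partial derivatives sum up to all
    directional derivatives: moving by [h (v + w)] is moving by [h v] and then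
    by [h w], and by the mean value theorem the second move costs [h] times a
    value of ['D_w f] near [x]. *)
Lemma is_derive_addr f x v w (a : R) :
  (forall y, derivable f y w) -> {for x, continuous (fun y => 'D_w f y)} ->
  is_derive x v f a -> is_derive x (v + w) f (a + 'D_w f x).
Proof.
move=> fw cw fv.
pose q2 (h : R) := h^-1 *: (f (h *: v + x) - f x).
pose q1 (h : R) := h^-1 *: (f (h *: w + (h *: v + x)) - f (h *: v + x)).
have q2a : q2 h @[h --> 0^'] --> a by case: fv => fv <-.
have q1b : q1 h @[h --> 0^'] --> 'D_w f x.
  apply/cvgrPdist_lt => e e0.
  have [d /= d0 dP] := (nbhs_ballP x _).1 ((cvgrPdist_lt _ _).1 cw e e0).
  have vw0 : 0 < `|v| + `|w| + 1 by rewrite ltr_wpDl// addr_ge0.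
  near=> h.
  have h0 : h != 0 by near: h; exact: nbhs_dnbhs_neq.
  have hd : `|h| < d / (`|v| + `|w| + 1).
    near: h; apply: dnbhs0_lt; exact: divr_gt0.
  have hw y : is_derive y (h *: w) f (h * 'D_w f y).
    by apply: is_derive_scale; apply: DeriveDef.
  have [s /andP[s0 s1]] := segment_MVT (h *: v + x) hw.
  rewrite /q1 => ->; rewrite [_ *: _]mulKf//; apply: dP.
  rewrite -ball_normE /=.
  have -> : x - (s *: (h *: w) + (h *: v + x)) = - (h *: (s *: w + v)).
    by rewrite addrA opprD addrCA subrr addr0 scalerDr !scalerA mulrC.
  rewrite normrN normrZ; apply: le_lt_trans (_ : `|h| * (`|v| + `|w| + 1) < d).
    apply: ler_wpM2l => //; apply: le_trans (ler_normD _ _) _.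
    rewrite [`|v| + _]addrC normrZ ger0_norm// -[leLHS]addr0.
    by apply: lerD => //; apply: lerD => //; rewrite ler_piMl.
  by rewrite -ltr_pdivlMr.
have E : (fun h : R => h^-1 *: ((f \o shift x) (h *: (v + w)) - f x)) =
    fun h => q2 h + q1 h.
  apply/funext => h /=; rewrite /q1 /q2 -scalerDr; congr (_ *: _).
  have -> : h *: (v + w) + x = h *: w + (h *: v + x).
    by rewrite scalerDr -addrA addrCA.
  by rewrite [RHS]addrC subrKA.
have cv : (fun h => q2 h + q1 h) h @[h --> 0^'] --> a + 'D_w f x.
  exact: cvgD.
split; first by rewrite /derivable E; apply/cvg_ex; eexists; exact: cv.
by rewrite /derive E; apply: cvg_lim.
Unshelve. all: by end_near. Qed.

End DirectionSums.

Lemma first_derivative_test (R : realType) (g dg : R -> R) :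
  (\forall s \near (0 : R), is_derive (s : R) 1 g (dg s)) ->
  (\forall s \near (0 : R), g s <= g 0) -> dg 0 = 0.
Proof.
move=> gd gmax.
have [r /= r0 rP] := (nbhs_ballP (0 : R) _).1 (filterI gd gmax).
have d (s : R) : s \in `]- r, r[%R -> is_derive s 1 g (dg s) /\ g s <= g 0.
  by rewrite in_itv /= -ltr_norml => sr; apply: rP; rewrite -ball_normE /= sub0r normrN.
have rr : - r <= r by lra.
have z : (0 : R) \in `]- r, r[%R by rewrite in_itv /= oppr_lt0 r0.
have H := @derive1_at_max R g (- r) r 0 rr
  (fun s h => @ex_derive _ _ _ _ _ _ _ (d s h).1) z (fun s h => (d s h).2).
by rewrite -(@derive_val _ _ _ _ _ _ _ (d _ z).1) (@derive_val _ _ _ _ _ _ _ H).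
Qed.

(** The derivative has to be differentiable at the maximum only: elsewhere
    [psi (u)] need not be twice differentiable. *)
Lemma second_derivative_test (R : realType) (g dg : R -> R) (c : R) :
  (\forall s \near (0 : R), is_derive (s : R) 1 g (dg s)) ->
  is_derive (0 : R) 1 dg c -> (\forall s \near (0 : R), g s <= g 0) ->
  c <= 0.
Proof.
move=> gd dgc gmax.
have [r r0 rP] : exists2 r : R, 0 < r &
    forall s : R, `|s| < r -> is_derive s 1 g (dg s) /\ g s <= g 0.
  have [r /= r0 rP] := (nbhs_ballP (0 : R) _).1 (filterI gd gmax).
  by exists r => // s sr; apply: rP; rewrite -ball_normE /= sub0r normrN.
have dg0 : dg 0 = 0 by exact: first_derivative_test gd gmax.
rewrite leNgt; apply/negP => c0.
(* if [c > 0], then [dg > 0] just to the right of [0] and [g] increases there *)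
have [h [hE hc h0]] := (is_derive1_caratheodory dg 0 c).1 dgc.
have /nbhs_ballP[e /= e0 eP] : \forall z \near (0 : R), 0 < h z.
  by apply: cvgr_gt hc _ _; rewrite h0.
pose t := Num.min e r / 2.
have t0 : 0 < t by rewrite divr_gt0// lt_min e0.
have te : t < e by rewrite ltr_pdivrMr// gt_min; apply/orP; left; lra.
have tr : t < r by rewrite ltr_pdivrMr// gt_min; apply/orP; right; lra.
have ds (s : R) : 0 <= s <= t -> is_derive s 1 g (dg s).
  by move=> /andP[s0 st]; apply: (rP _ _).1; rewrite ger0_norm//; lra.
have [s st||s st] := @MVT R g dg 0 t t0.
- by apply: ds; move: st; rewrite in_itv /= => /andP[/ltW -> /ltW ->].
- apply: derivable_within_continuous => s; rewrite in_itv /= => sP.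
  exact: (@ex_derive _ _ _ _ _ _ _ (ds s sP)).
move: st; rewrite in_itv /= => /andP[s0 st].
rewrite subr0 => gE.
have := hE s; rewrite dg0 !subr0 => dgs.
have := (rP t _).2; rewrite gtr0_norm// => /(_ tr) gt.
have hs : 0 < h s by apply: eP; rewrite -ball_normE /= sub0r normrN gtr0_norm//; lra.
have : 0 < dg s * t by rewrite dgs; do 2?apply: mulr_gt0 => //.
by rewrite -gE; lra.
Qed.

(** * Lebesgue null sets have empty interior *)

Section BoxMeasure.
Context {R : realType}.

Lemma integral_scaled_segment (c a b : R) : 0 <= c ->
  (\int[lebesgue_measure]_t (c * \1_(`[a, b] : set R) t)%:E
    = (c * Num.max 0 (b - a))%:E)%E.
Proof.
move=> c0; under eq_integral do rewrite EFinM.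
have mab : measurable (`[a, b] : set R) by exact: measurable_itv.
rewrite ge0_integralZl_EFin//; last first.
  exact/measurable_EFinP/measurable_indic.
rewrite integral_indic// setIT.
transitivity (c%:E * lebesgue_measure (`[a, b] : set R))%E => //.
rewrite (lebesgue_measure_itv `[a, b]%R)/= lte_fin EFinM.
congr (_ * _)%E; case: ltP => ab; rewrite -?EFinB; congr (_%:E).
  by rewrite max_r// subr_ge0 ltW.
by rewrite max_l// subr_le0.
Qed.

(** Integrating out the last coordinate
    with the one-dimensional Lebesgue measure turns the [m.+1]-dimensional
    hypothesis into the [m]-dimensional one, with each weight multiplied by the
    side length; this is why weights are allowed. *)
Lemma box_sum_ge m (d : R) (c : nat -> R) (a b : nat -> R)
    (A B : nat -> nat -> R) :
  0 <= d -> (forall k, 0 <= c k) ->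
  (forall x : nat -> R,
    ((d * \prod_(i < m) \1_(`[a i, b i] : set R) (x i))%:E <=
     \sum_(0 <= k <oo)
       (c k * \prod_(i < m) \1_(`[A k i, B k i] : set R) (x i))%:E)%E) ->
  ((d * \prod_(i < m) Num.max 0 (b i - a i))%:E <=
   \sum_(0 <= k <oo) (c k * \prod_(i < m) Num.max 0 (B k i - A k i))%:E)%E.
Proof.
elim: m d c => [|m IH] d c d0 c0 H.
  by have := H (fun=> 0); under eq_eseriesr do rewrite big_ord0; rewrite !big_ord0;
    under [X in _ -> (_ <= X)%E]eq_eseriesr do rewrite big_ord0.
have indic_ge0 (X : set R) t : 0 <= \1_X t :> R by rewrite indicE.
rewrite big_ord_recr/= mulrCA mulrC.
under eq_eseriesr do rewrite big_ord_recr/= mulrCA mulrC.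
have max0 (y : R) : 0 <= Num.max 0 y by rewrite le_max lexx.
apply: IH => [||x]; first exact: mulr_ge0.
  by move=> k; exact: mulr_ge0.
pose P : R := \prod_(i < m) \1_(`[a i, b i] : set R) (x i).
pose Q k : R := \prod_(i < m) \1_(`[A k i, B k i] : set R) (x i).
have P0 : 0 <= P by apply: prodr_ge0.
have Q0 k : 0 <= Q k by apply: prodr_ge0.
have mf (e s t : R) : measurable_fun setT (fun r => (e * \1_(`[s, t] : set R) r)%:E).
  by apply/measurable_EFinP; apply: measurable_funM.
have : (\int[lebesgue_measure]_t ((d * P) * \1_(`[a m, b m] : set R) t)%:E <=
  \int[lebesgue_measure]_t \sum_(0 <= k <oo)
     ((c k * Q k) * \1_(`[A k m, B k m] : set R) t)%:E)%E.
  apply: ge0_le_integral => //.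
  - by move=> t _; rewrite lee_fin !mulr_ge0.
  - exact: mf.
  - have := @ge0_emeasurable_sum _ _ R setT
      (fun k t => ((c k * Q k) * \1_(`[A k m, B k m] : set R) t)%:E) xpredT.
    apply=> [k t _ _|k _]; last exact: mf.
    by rewrite lee_fin !mulr_ge0.
  move=> t _.
  pose y i := if (i < m)%N then x i else t.
  have Pr (a' b' : nat -> R) e : e * \prod_(i < m.+1) \1_(`[a' i, b' i] : set R) (y i) =
     e * \prod_(i < m) \1_(`[a' i, b' i] : set R) (x i) * \1_(`[a' m, b' m] : set R) t.
    have ym : y m = t by rewrite /y ltnn.
    rewrite big_ord_recr/= ym mulrA; congr (_ * _ * _).
    by apply: eq_bigr => i _; rewrite /y ltn_ord.
  have := H y; rewrite Pr => /le_trans; apply; apply: lee_nneseries => k _.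
    by rewrite lee_fin mulr_ge0// prodr_ge0.
  by rewrite Pr.
rewrite integral_nneseries//; first last.
- by move=> k t _; rewrite lee_fin !mulr_ge0.
- by move=> k; exact: mf.
rewrite integral_scaled_segment ?mulr_ge0//.
under eq_eseriesr do rewrite integral_scaled_segment ?mulr_ge0//.
rewrite mulrAC => /le_trans; apply; apply: lee_nneseries => k _.
  by rewrite lee_fin !mulr_ge0.
by rewrite mulrAC.
Qed.

Context {n : nat}.
Implicit Types (p : 'rV[R]_n * R).

(** Space-time coordinates numbered consecutively, time coming last. *)
Definition coord p (i : nat) : R :=
  if insub i is Some j then p.1 0 (j : 'I_n) else p.2.

Lemma coord_space p (i : 'I_n) : coord p i = p.1 0 i.
Proof. by rewrite /coord valK. Qed.

Lemma coord_time p : coord p n = p.2.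
Proof. by rewrite /coord insubN ?ltnn. Qed.

Lemma box_volume_coord p q :
  box_volume p q = \prod_(i < n.+1) Num.max 0 (coord q i - coord p i).
Proof.
rewrite big_ord_recr/= !coord_time; congr (_ * _).
by apply: eq_bigr => i _; rewrite !coord_space.
Qed.

Lemma box_indic p q r :
  \prod_(i < n.+1) \1_(`[coord p i, coord q i] : set R) (coord r i) =
  \1_(box p q) r :> R.
Proof.
rewrite big_ord_recr/= !coord_time.
under eq_bigr do rewrite !coord_space.
have [rb|rb] := pselect (box p q r).
  rewrite [RHS]indicE mem_set// big1 ?mul1r.
    by rewrite indicE mem_set//= in_itv/=; case: rb.
  by move=> i _; rewrite indicE mem_set//= in_itv/=; case: rb.
rewrite [RHS]indicE memNset//.
have [tb|tb] := boolP (p.2 <= r.2 <= q.2); last first.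
  by rewrite [X in _ * X]indicE memNset ?mulr0//= in_itv/=; exact/negP.
have [xb|/existsNP[i]] := pselect (forall i, p.1 0 i <= r.1 0 i <= q.1 0 i).
  by case: rb.
by move=> /negP xi; rewrite (bigD1 i)//= indicE memNset ?mul0r//= in_itv/=; exact/negP.
Qed.

(** The outer measure is an infimum over countable covers by boxes; the indicators
    of the boxes of a cover sum to at least the indicator of the covered box. *)
Lemma lebesgue_outer_box p q (S : set ('rV[R]_n * R)) :
  box p q `<=` S -> ((box_volume p q)%:E <= lebesgue_outer S)%E.
Proof.
move=> pqS; apply: le_ereal_inf_tmp => _ [a [b [Sab ->]]].
have := @box_sum_ge n.+1 1 (fun=> 1) (coord p) (coord q)
  (fun k => coord (a k)) (fun k => coord (b k)) ler01 (fun=> ler01).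
rewrite mul1r -box_volume_coord.
under [X in _ -> (_ <= X)%E]eq_eseriesr do rewrite mul1r -box_volume_coord.
apply=> x; pose r : 'rV[R]_n * R := (\row_i x i, x n).
have Pr (s t : 'rV[R]_n * R) :
    1 * \prod_(i < n.+1) \1_(`[coord s i, coord t i] : set R) (x i) =
    \1_(box s t) r :> R.
  rewrite mul1r -box_indic; apply: eq_bigr => i _; congr (\1_ _ _).
  have [im|] := ltnP i n; first by rewrite (coord_space r (Ordinal im)) mxE.
  move=> ni; have -> : nat_of_ord i = n by apply/eqP; rewrite eqn_leq ni -ltnS ltn_ord.
  by rewrite coord_time.
rewrite Pr; under eq_eseriesr do rewrite Pr.
have ind0 k : (0 <= (\1_(box (a k) (b k)) r : R)%:E)%E by rewrite lee_fin indicE.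
have [rpq|rpq] := pselect (box p q r); last first.
  by rewrite indicE memNset//; exact: nneseries_ge0.
have [k _ rk] := Sab _ (pqS _ rpq).
rewrite (@nneseriesD1 _ _ k xpredT (fun i _ => ind0 i) isT).
rewrite indicE mem_set// [X in (_ <= X%:E + _)%E]indicE mem_set//.
by rewrite leeDl//; apply: nneseries_ge0 => *; exact: ind0.
Qed.

End BoxMeasure.

(** * Continuous functions on the slab *)

Section Slab.
Context {R : realType} {n : nat} (T : R).
Implicit Types (f u : 'rV[R]_n -> R -> R) (x y : 'rV[R]_n) (s t : R).

Lemma rV_ballP x y (d : R) : 0 < d ->
  (forall i, `|x 0 i - y 0 i| < d) -> ball x d y.
Proof.
by move=> d0 xy; split=> // i j; rewrite (ord1 i) -ball_normE; exact: xy.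
Qed.

Lemma continuous_slabP f x t (e : R) : continuous_slab T f -> 0 <= t <= T ->
  0 < e -> exists2 d : R, 0 < d & forall y s, 0 <= s <= T -> ball x d y ->
    `|t - s| < d -> `|f x t - f y s| < e.
Proof.
move=> /subspace_continuousP cf t0T e0.
have xt : ([set: 'rV[R]_n] `*` `[0, T]%classic) (x, t) by split=> //=; rewrite in_itv.
have [d /= d0 dP] := (nbhs_ballP (x, t) _).1 ((cvgrPdist_lt _ _).1 (cf _ xt) e e0).
exists d => // y s s0T xy ts.
by apply: (dP (y, s)) => //=; split=> //=; rewrite ?in_itv// -ball_normE.
Qed.

Lemma continuous_slab_space f t : continuous_slab T f -> 0 <= t <= T ->
  continuous (f^~ t).
Proof.
move=> cf t0T x; suff: f y t @[y --> x] --> f x t by [].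
apply/(cvgrPdist_lt (FF := nbhs_filter x)) => e e0.
have [d d0 dP] := continuous_slabP x cf t0T e0.
apply/nbhs_ballP; exists d => //= y xy; apply: dP => //.
by rewrite subrr normr0.
Qed.

(** An essential bound of a function that is continuous on the slab bounds it
    everywhere there: a point that violates it has a whole box of violating
    points around it (one-sided in time at the ends of the slab), and boxes of
    positive volume are not null. *)
Lemma Linfty_slab_bounded u (eps : R) : 0 < T -> 0 < eps ->
  continuous_slab T u -> Linfty ([set: 'rV[R]_n] `*` `]- eps, T[) u ->
  exists M, forall x t, 0 <= t <= T -> `|u x t| <= M.
Proof.
move=> T0 eps0 cu [_ [M nullM]]; exists M => x t t0T.
rewrite leNgt; apply/negP => uM.
have [d d0 dP] : exists2 d : R, 0 < d & forall y s, 0 <= s <= T ->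
    ball x d y -> `|t - s| < d -> M < `|u y s|.
  have [|d d0 dP] := @continuous_slabP _ x t (`|u x t| - M) cu t0T.
    by rewrite subr_gt0.
  exists d => // y s s0T xy ts; have := dP y s s0T xy ts.
  have := ler_distD (u y s) (u x t) 0; rewrite !subr0; lra.
(* the time interval [l, r] has length [th T / 2] and lies within [th T] of [t];
   shrinking [t] to [t (1 - th)] keeps it inside [0, T[ even for [t = T] *)
pose th := Num.min 1 (d / (2 * T)).
have th0 : 0 < th by rewrite lt_min ltr01 divr_gt0// mulr_gt0.
have th1 : th <= 1 by rewrite ge_min lexx.
have thT : th * T < d.
  apply: le_lt_trans (_ : d / 2 < d); last by lra.
  apply: le_trans (_ : d / (2 * T) * T <= _).
    by apply: ler_wpM2r; [exact: ltW|rewrite /th ge_min lexx orbT].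
  by rewrite invfM mulrA mulfVK// gt_eqF.
move: (t0T) => /andP[t0 tT].
pose l := t * (1 - th); pose r := t * (1 - th) + th * T / 2.
have lr : 0 < r - l by rewrite /l /r; nra.
pose p : 'rV[R]_n * R := (\row_i (x 0 i - d / 2), l).
pose q : 'rV[R]_n * R := (\row_i (x 0 i + d / 2), r).
have pq : box p q `<=` ([set: 'rV[R]_n] `*` `]- eps, T[) `&`
    [set z | M < `|u z.1 z.2|].
  move=> [y s] [/= yb /andP[ls sr]].
  have s0 : 0 <= s by rewrite /l in ls; nra.
  have sT : s < T by rewrite /r in sr; nra.
  split; first by split=> //=; rewrite in_itv/= sT andbT; lra.
  apply: dP => /=.
  - by rewrite s0 ltW.
  - apply: rV_ballP => // i; have := yb i; rewrite !mxE => /andP[y1 y2].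
    by rewrite ltr_norml; apply/andP; split; lra.
  - by rewrite ltr_norml; rewrite /l /r in ls sr; apply/andP; split; nra.
have := lebesgue_outer_box pq; rewrite nullM lee_fin leNgt => /negP; apply.
rewrite /box_volume mulr_gt0//=; last by rewrite lt_max lr orbT.
apply: prodr_gt0 => i _; rewrite !mxE lt_max; apply/orP; right; lra.
Qed.

End Slab.

(** * Quadratic forms and the square root of the coefficient matrix *)

Section Bilinear.
Context {R : realType} {n : nat}.
Implicit Types (H : 'M[R]_n) (a b c p : 'rV[R]_n).

Definition bil H a b : R := (a *m H *m b^T) 0 0.
Definition dot a b : R := bil 1%:M a b.

Lemma bilE H a b : bil H a b = \sum_i \sum_j a 0 i * H i j * b 0 j.
Proof.
rewrite /bil mxE exchange_big/=; apply: eq_bigr => j _.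
by rewrite !mxE big_distrl.
Qed.

Lemma dotE a b : dot a b = \sum_i a 0 i * b 0 i.
Proof. by rewrite /dot /bil mulmx1 mxE; apply: eq_bigr => i _; rewrite mxE. Qed.

Lemma bilDl H a b c : bil H (a + b) c = bil H a c + bil H b c.
Proof. by rewrite /bil !mulmxDl mxE. Qed.
Lemma bilDr H a b c : bil H c (a + b) = bil H c a + bil H c b.
Proof. by rewrite /bil linearD mulmxDr mxE. Qed.
Lemma bilNl H a b : bil H (- a) b = - bil H a b.
Proof. by rewrite /bil !mulNmx mxE. Qed.
Lemma bilNr H a b : bil H a (- b) = - bil H a b.
Proof. by rewrite /bil linearN mulmxN mxE. Qed.
Lemma bilZl H k a b : bil H (k *: a) b = k * bil H a b.
Proof. by rewrite /bil -!scalemxAl mxE. Qed.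
Lemma bilZr H k a b : bil H a (k *: b) = k * bil H a b.
Proof. by rewrite /bil linearZ -scalemxAr mxE. Qed.

Definition bil_lin := (bilDl, bilDr, bilNl, bilNr, bilZl, bilZr).

Lemma dotC a b : dot a b = dot b a.
Proof. by rewrite !dotE; apply: eq_bigr => i _; rewrite mulrC. Qed.

Lemma dot_ge0 a : 0 <= dot a a.
Proof. by rewrite dotE sumr_ge0// => i _; exact: sqr_ge0. Qed.

Lemma dot_eq0 a : dot a a = 0 -> a = 0.
Proof.
rewrite dotE => /eqP; rewrite psumr_eq0 => [|i _]; last exact: sqr_ge0.
move=> /allP a0; apply/rowP => i; rewrite mxE.
by have := a0 i (mem_index_enum i); rewrite mulf_eq0 orbb => /eqP.
Qed.

Lemma dot_CS a b : dot a b ^+ 2 <= dot a a * dot b b.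
Proof.
have [b0|b0] := eqVneq (dot b b) 0.
  by rewrite (dot_eq0 b0) /dot /bil trmx0 !mulmx0 mxE expr0n mulr0.
have bp : 0 < dot b b by rewrite lt_neqAle eq_sym b0 dot_ge0.
have E : dot (dot b b *: a - dot a b *: b) (dot b b *: a - dot a b *: b) =
    dot b b * (dot a a * dot b b - dot a b ^+ 2).
  by have := dotC b a; rewrite /dot !bil_lin => ->; ring.
have := dot_ge0 (dot b b *: a - dot a b *: b).
rewrite E.
by rewrite pmulr_rge0// subr_ge0.
Qed.

Lemma enormE a : enorm a = Num.sqrt (dot a a).
Proof. by rewrite /enorm dotE; congr Num.sqrt; apply: eq_bigr. Qed.

Lemma sqr_enorm a : enorm a ^+ 2 = dot a a.
Proof. by rewrite enormE sqr_sqrtr// dot_ge0. Qed.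

Lemma enorm_ge0 a : 0 <= enorm a.
Proof. exact: sqrtr_ge0. Qed.

Lemma dot_le_enorm a b : dot a b <= enorm a * enorm b.
Proof.
apply: le_trans (ler_norm _) _; rewrite -sqrtr_sqr !enormE -sqrtrM ?dot_ge0//.
by rewrite ler_wsqrtr// dot_CS.
Qed.

Lemma bil_delta H i j : bil H (delta_mx 0 i) (delta_mx 0 j) = H i j.
Proof.
rewrite /bil -rowE mxE (bigD1 j)//= !mxE !eqxx mulr1 big1 ?addr0// => k kj.
by rewrite !mxE/= (negbTE kj) mulr0.
Qed.

Lemma dot_delta a i : dot a (delta_mx 0 i) = a 0 i.
Proof.
rewrite dotE (bigD1 i)//= mxE !eqxx mulr1 big1 ?addr0// => k ki.
by rewrite mxE/= (negbTE ki) mulr0.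
Qed.

(** The rows of the symmetric square root [1 - p (x) p / (v (v + 1))] of the
    coefficient matrix [1 - p (x) p / v ^ 2], where [v] is [sqrt (1 + |p|^2)]. *)
Definition sqrt_row p v k : 'rV[R]_n :=
  delta_mx 0 k - (p 0 k / (v * (v + 1))) *: p.

Lemma sum_sqrt_row H p v : 0 < v -> v ^+ 2 = 1 + dot p p ->
  \sum_k bil H (sqrt_row p v k) (sqrt_row p v k) =
  \tr H - bil H p p / v ^+ 2.
Proof.
move=> v0 v2; set be := (v * (v + 1))^-1.
have E k : bil H (sqrt_row p v k) (sqrt_row p v k) =
  H k k - be * (p 0 k * bil H (delta_mx 0 k) p + p 0 k * bil H p (delta_mx 0 k))
  + (be ^+ 2 * bil H p p) * (p 0 k * p 0 k).
  by rewrite /sqrt_row !bil_lin bil_delta -/be; ring.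
rewrite (eq_bigr _ (fun k _ => E k)) big_split/= sumrB -!mulr_sumr big_split/=.
have pd : p = \sum_k p 0 k *: delta_mx 0 k by exact: row_sum_delta.
have -> : \sum_k p 0 k * bil H (delta_mx 0 k) p = bil H p p.
  rewrite {3}pd /bil !mulmx_suml summxE; apply: eq_bigr => k _.
  by rewrite -!scalemxAl [RHS]mxE.
have -> : \sum_k p 0 k * bil H p (delta_mx 0 k) = bil H p p.
  rewrite {4}pd /bil linear_sum/= mulmx_sumr summxE; apply: eq_bigr => k _.
  by rewrite linearZ/= -scalemxAr [RHS]mxE.
rewrite -dotE; have -> : dot p p = v ^+ 2 - 1 by rewrite v2; ring.
have -> : \sum_k H k k = \tr H by [].
by rewrite /be; field; rewrite !gt_eqF//; lra.
Qed.

End Bilinear.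

(** * Functions of class C^2 and the mean curvature operator *)

Section Multivariate.
Context {R : realType} {n : nat}.
Implicit Types (f : 'rV[R]_n -> R) (x v : 'rV[R]_n).

Definition C1_space f :=
  forall i, (forall x, pderivable i f x) /\ continuous (pderiv i f).

Definition C2_space f := C1_space f /\ forall i, C1_space (pderiv i f).

Definition hess f x : 'M[R]_n := \matrix_(i, j) pderiv j (pderiv i f) x.

(** The coordinate directions are added up one at a time by [is_derive_addr]. *)
Lemma is_derive_grad f x v : C1_space f -> is_derive x v f (dot (grad f x) v).
Proof.
move=> cf; rewrite dotE; under eq_bigr do rewrite mxE.
rewrite {1}(row_sum_delta v).
elim: (index_enum 'I_n) => [|i s IH]; first by rewrite !big_nil; exact: is_derive0.
rewrite !big_cons addrC [X in is_derive _ _ _ X]addrC.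
have d y : is_derive y (v 0 i *: delta_mx 0 i) f (v 0 i * pderiv i f y).
  by apply: is_derive_scale; apply: DeriveDef; [exact: (cf i).1|].
have E : (fun y => 'D_(v 0 i *: delta_mx 0 i) f y) = fun y => v 0 i * pderiv i f y.
  by apply/funext => y; exact: (@derive_val _ _ _ _ _ _ _ (d y)).
rewrite [pderiv i f x * _]mulrC.
have <- : 'D_(v 0 i *: delta_mx 0 i) f x = v 0 i * pderiv i f x.
  exact: (@derive_val _ _ _ _ _ _ _ (d x)).
apply: is_derive_addr IH => [y|]; first exact: (@ex_derive _ _ _ _ _ _ _ (d y)).
rewrite E; apply: (@cvgM _ _ _ (nbhs_filter x) (fun=> v 0 i)) => [|y].
  exact: cvg_cst.
exact: (cf i).2.
Qed.

Lemma is_derive_grad_dot f x v w : C2_space f ->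
  is_derive x v (fun y => dot (grad f y) w) (bil (hess f x) w v).
Proof.
move=> [_ cf]; have E : (fun y => dot (grad f y) w) =
    fun y => \sum_i pderiv i f y * w 0 i.
  by apply/funext => y; rewrite dotE; apply: eq_bigr => i _; rewrite mxE.
rewrite E bilE; apply: is_derive_sumf => i.
have := is_deriveMf (is_derive_grad x v (cf i)) (is_derive_cst (w 0 i) x v).
rewrite mulr0 add0r /cst => /is_derive_eq; apply.
rewrite dotE mulr_sumr; apply: eq_bigr => j _; rewrite !mxE; ring.
Qed.

Lemma slope_gt0 f x : 0 < slope f x.
Proof. by rewrite sqrtr_gt0 ltr_pwDl// exprn_ge0// enorm_ge0. Qed.

Lemma sqr_slope f x : slope f x ^+ 2 = 1 + dot (grad f x) (grad f x).
Proof. by rewrite sqr_sqrtr ?sqr_enorm// addr_ge0// dot_ge0. Qed.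

(** The nondivergence form: differentiating the factor [1 / v] of [Du / v], where
    [v] is the slope, produces the Hessian evaluated at the gradient. *)
Lemma slope_mean_curvature f x : C2_space f ->
  slope f x * mean_curvature f x =
  \tr (hess f x) - bil (hess f x) (grad f x) (grad f x) / slope f x ^+ 2.
Proof.
move=> cf; have [_ cfi] := cf.
pose s2 y := 1 + \sum_j pderiv j f y * pderiv j f y.
have slE y : slope f y = Num.sqrt (s2 y).
  rewrite /slope sqr_enorm dotE; congr (Num.sqrt (_ + _)).
  by apply: eq_bigr => j _; rewrite !mxE.
have s2p y : 0 < s2 y by rewrite -sqrtr_gt0 -slE slope_gt0.
have dslope i : is_derive x (delta_mx 0 i) (slope f)
    ((slope f x)^-1 * \sum_j pderiv j f x * hess f x j i).
  have d2 : is_derive x (delta_mx 0 i) s2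
     (0 + \sum_j (pderiv j f x * hess f x j i + pderiv j f x * hess f x j i)).
    apply: (@is_deriveDf _ _ (cst 1)).
    apply: is_derive_sumf => j; rewrite mxE.
    by apply: is_deriveMf; apply: DeriveDef => //; exact: (cfi j i).1.
  have := is_derive_comp1 (is_derive1_sqrt (s2p x)) d2.
  have -> : (fun y => Num.sqrt (s2 y)) = slope f by apply/funext => y; rewrite slE.
  move=> /is_derive_eq; apply; rewrite -slE add0r big_split/=.
  by have := slope_gt0 f x => s0; field; rewrite gt_eqF.
rewrite /mean_curvature /divergence.
have E i : pderiv i (fun y => ((slope f y)^-1 *: grad f y) 0 i) x =
  (slope f x)^-1 * hess f x i i - (slope f x) ^- 3 *
     (pderiv i f x * \sum_j pderiv j f x * hess f x j i).
  have -> : (fun y => ((slope f y)^-1 *: grad f y) 0 i) =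
      fun y => (slope f y)^-1 * pderiv i f y by apply/funext => y; rewrite !mxE.
  have s0 := slope_gt0 f x.
  have dV : is_derive (slope f x) 1 (fun r : R => r^-1) (- (slope f x) ^- 2).
    have := @is_deriveV _ id (slope f x) 1 1 (lt0r_neq0 s0) (is_derive_id _ _).
    by move=> /is_derive_eq; apply; rewrite [_ *: _]mulr1.
  have di : is_derive x (delta_mx 0 i) (pderiv i f) (hess f x i i).
    by rewrite mxE; apply: DeriveDef => //; exact: (cfi i i).1.
  have := is_deriveMf (is_derive_comp1 dV (dslope i)) di.
  move=> /(@derive_val _ _ _ _ _ _ _); rewrite /pderiv => ->.
  by field; rewrite gt_eqF.
rewrite (eq_bigr _ (fun i _ => E i)) sumrB -!mulr_sumr.
have -> : \sum_i pderiv i f x * (\sum_j pderiv j f x * hess f x j i) =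
    bil (hess f x) (grad f x) (grad f x).
  rewrite bilE exchange_big; apply: eq_bigr => i _; rewrite mulr_sumr.
  by apply: eq_bigr => j _; rewrite !mxE; ring.
rewrite /mxtrace; have s0 := slope_gt0 f x.
by field; rewrite gt_eqF.
Qed.

End Multivariate.

(** * The one-dimensional profile *)

Lemma continuous_primitive (R : realType) (g : R -> R) (a : R) : continuous g ->
  exists G : R -> R, forall r : R, a < r -> is_derive r 1 G (g r).
Proof.
move=> cg; exists (fun x => \int[lebesgue_measure]_(t in `[a, x]) g t)%R => r ar.
have rr1 : r < r + 1 by rewrite ltrDl.
have ig : lebesgue_measure.-integrable `[a, r + 1] (EFin \o g).
  apply: continuous_compact_integrable; first exact: segment_compact.
  exact: continuous_subspaceT.
have [d e] := continuous_FTC1_closed rr1 ig ar (cg r).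
by rewrite derive1E in e; apply: DeriveDef.
Qed.

Section Profile.
Context {R : realType} (F : R -> R) (delta : R).
Hypotheses (delta0 : 0 < delta) (delta1 : delta < 1).
Hypotheses (F0 : forall r, 0 <= F r) (dF : forall r : R, derivable F r 1).

(** The stationary profile [q] with
    [1 - (1 + q'^2)^(-1/2) = F (q) + delta] has slope angle with this cosine and
    sine at height [r]; the cotangent [1 / q'] is the derivative of the inverse
    function of [q].  At heights with [F + delta >= 1] every slope is admissible;
    truncating the cosine at [0] makes the inverse function constant there. *)
Definition profile_cos r : R := Num.max 0 (1 - delta - F r).
Definition profile_sin r : R := Num.sqrt (1 - profile_cos r ^+ 2).
Definition profile_cot r : R := profile_cos r / profile_sin r.

Lemma profile_cos_ge0 r : 0 <= profile_cos r. Proof. by rewrite le_max lexx. Qed.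

Lemma profile_cos_le r : profile_cos r <= 1 - delta.
Proof.
have h1 : 0 <= 1 - delta by rewrite subr_ge0 ltW.
have h2 : 1 - delta - F r <= 1 - delta by move: (F0 r) => h; lra.
by rewrite ge_max h1.
Qed.

Lemma one_minus_profile_cos2 r : delta <= 1 - profile_cos r ^+ 2.
Proof.
have c0 := profile_cos_ge0 r; have c1 := profile_cos_le r.
have c2 : profile_cos r <= 1 by move: delta0 => d0; lra.
by move: (ler_piMr c0 c2); rewrite -expr2 => h; lra.
Qed.

Lemma sqr_profile_sin r : profile_sin r ^+ 2 = 1 - profile_cos r ^+ 2.
Proof. by rewrite sqr_sqrtr// (le_trans _ (one_minus_profile_cos2 r))// ltW. Qed.

Lemma profile_sin_ge r : delta <= profile_sin r.
Proof.
have h := one_minus_profile_cos2 r; rewrite -[leLHS](ger0_norm (ltW delta0)) -sqrtr_sqr.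
rewrite ler_wsqrtr//; apply: le_trans h.
by rewrite expr2 ler_piMr// ltW.
Qed.

Lemma profile_sin_gt0 r : 0 < profile_sin r.
Proof. exact: lt_le_trans (profile_sin_ge r). Qed.

Lemma profile_cot_ge0 r : 0 <= profile_cot r.
Proof. by rewrite divr_ge0// ?profile_cos_ge0// ltW// profile_sin_gt0. Qed.

Lemma profile_cot_le r : profile_cot r <= delta^-1.
Proof.
rewrite ler_pdivrMr ?profile_sin_gt0// -ler_pdivrMl ?invr_gt0// invrK.
have c1 := profile_cos_le r; apply: le_trans (_ : delta * 1 <= _).
  by rewrite ler_pM2l//; move: delta0 => d0; lra.
by rewrite mulr1 profile_sin_ge.
Qed.

Lemma profile_cos_continuous : continuous profile_cos.
Proof.
have -> : profile_cos = cst 0 \max (fun r => 1 - delta - F r) by [].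
move=> r; apply: continuous_max; first exact: cst_continuous.
apply: cvgB; first exact: cvg_cst.
by apply: differentiable_continuous; apply/derivable1_diffP; exact: dF.
Qed.

Lemma profile_cot_continuous : continuous profile_cot.
Proof.
move=> r; apply: cvgM; first exact: profile_cos_continuous.
apply: cvgV; first by rewrite gt_eqF// profile_sin_gt0.
apply: (@continuous_comp _ _ _ (fun r => 1 - profile_cos r ^+ 2)); last exact: sqrt_continuous.
apply: cvgB; first exact: cvg_cst.
by apply: cvgM; exact: profile_cos_continuous.
Qed.

(** Where [F + delta < 1] the truncation is inactive and the cotangent is a smooth
    function of [F], as [m / sqrt (1 - m^2)] has derivative [(1 - m^2)^(-3/2)]. *)
Lemma is_derive_profile_cot r : profile_cot r != 0 ->
  is_derive r 1 profile_cot (- (derive1 F r / profile_sin r ^+ 3)).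
Proof.
move=> c0; have m0 : 0 < profile_cos r.
  by rewrite lt_neqAle profile_cos_ge0 andbT; apply: contra c0 => /eqP m0;
     rewrite /profile_cot -m0 mul0r.
have lin0 : 0 < 1 - delta - F r by move: m0; rewrite lt_max ltxx.
have cF : {for r, continuous (fun s => 1 - delta - F s)}.
  apply: cvgB; first exact: cvg_cst.
  by apply: differentiable_continuous; apply/derivable1_diffP; exact: dF.
have dcos : is_derive r 1 profile_cos (- derive1 F r).
  have dlin : is_derive r 1 (fun s => 1 - delta - F s) (0 - derive1 F r).
    apply: (@is_deriveBf _ _ (cst (1 - delta))).
    by rewrite derive1E; apply: DeriveDef.
  rewrite sub0r in dlin; apply: near_eq_is_derive dlin.
  have : \forall s \near r, 0 < 1 - delta - F s by apply: cvgr_gt cF _ _.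
  by apply: filterS => s s0; rewrite /profile_cos max_r// ltW.
have c2 : 0 < 1 - profile_cos r ^+ 2 by apply: lt_le_trans (one_minus_profile_cos2 r).
have dsin : is_derive r 1 profile_sin (profile_cos r * derive1 F r / profile_sin r).
  have h := @is_deriveBf _ _ (cst 1) _ r 1 _ _ (is_derive_cst _ _ _) (is_deriveMf dcos dcos).
  have := @is_derive_comp1 _ _ Num.sqrt (fun y => 1 - profile_cos y ^+ 2) r 1 _ _
    (is_derive1_sqrt c2) h.
  move=> /is_derive_eq; apply; rewrite -/(profile_sin r).
  by have := profile_sin_gt0 r => w0; field; rewrite gt_eqF.
have w0 := profile_sin_gt0 r.
have dV : is_derive (profile_sin r) 1 (fun s : R => s^-1) (- (profile_sin r) ^- 2).
  have := @is_deriveV _ id (profile_sin r) 1 1 (lt0r_neq0 w0) (is_derive_id _ _).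
  by move=> /is_derive_eq; apply; rewrite [_ *: _]mulr1.
have := is_deriveMf dcos (is_derive_comp1 dV dsin).
move=> /is_derive_eq; apply.
transitivity (- (derive1 F r * (profile_sin r ^+ 2 + profile_cos r ^+ 2) / profile_sin r ^+ 3)).
  by field; rewrite gt_eqF.
by rewrite sqr_profile_sin subrK mulr1.
Qed.

End Profile.

(** * Optimality conditions at a maximum of the two-point function *)

Section Lines.
Context {R : realType} {n : nat}.
Implicit Types (x z v b : 'rV[R]_n) (s : R).

Lemma is_derive_line_dot x v b s :
  is_derive s 1 (fun r : R => dot (r *: v + x) b) (dot v b).
Proof.
have -> : (fun r : R => dot (r *: v + x) b) = fun r => r * dot v b + dot x b.
  by apply/funext => r; rewrite /dot !bil_lin.
have := is_deriveDf (is_deriveMf (is_derive_id s 1) (is_derive_cst (dot v b) s 1))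
  (is_derive_cst (dot x b) s 1).
by move=> /is_derive_eq; apply; rewrite /cst mulr0 mulr1 add0r addr0.
Qed.

Lemma is_derive_line_sqr x v s :
  is_derive s 1 (fun r : R => dot (r *: v + x) (r *: v + x))
    (2 * dot (s *: v + x) v).
Proof.
have -> : (fun r : R => dot (r *: v + x) (r *: v + x)) =
    fun r => r * dot (r *: v + x) v + dot (r *: v + x) x.
  apply/funext => r; rewrite {1}/dot !bilDr !bilZr -!/(dot _ _).
  by rewrite /dot !bil_lin.
have := is_deriveDf (is_deriveMf (is_derive_id s 1) (is_derive_line_dot x v v s))
  (is_derive_line_dot x v x s).
move=> /is_derive_eq; apply.
have := dotC v x; rewrite /dot !bil_lin => ->; ring.
Qed.

Lemma is_derive_line_enorm x v s : 0 < enorm (s *: v + x) ->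
  is_derive s 1 (fun r : R => enorm (r *: v + x))
    (dot (s *: v + x) v / enorm (s *: v + x)).
Proof.
move=> h; have -> : (fun r : R => enorm (r *: v + x)) =
    fun r => Num.sqrt (dot (r *: v + x) (r *: v + x)).
  by apply/funext => r; rewrite enormE.
have h2 : 0 < dot (s *: v + x) (s *: v + x) by rewrite -sqr_enorm exprn_gt0.
have := @is_derive_comp1 _ _ Num.sqrt (fun r : R => dot (r *: v + x) (r *: v + x))
  s 1 _ _ (is_derive1_sqrt h2) (is_derive_line_sqr x v s).
move=> /is_derive_eq; apply; rewrite -enormE.
by field; rewrite gt_eqF.
Qed.

Lemma is_derive2_line_enorm x v s : 0 < enorm (s *: v + x) ->
  is_derive s 1 (fun r : R => dot (r *: v + x) v / enorm (r *: v + x))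
    ((dot v v - (dot (s *: v + x) v / enorm (s *: v + x)) ^+ 2)
       / enorm (s *: v + x)).
Proof.
move=> h; have dV : is_derive (enorm (s *: v + x)) 1 (fun r : R => r^-1)
    (- (enorm (s *: v + x)) ^- 2).
  have := @is_deriveV _ id _ 1 1 (lt0r_neq0 h) (is_derive_id _ _).
  by move=> /is_derive_eq; apply; rewrite [_ *: _]mulr1.
have := is_deriveMf (is_derive_line_dot x v v s)
  (@is_derive_comp1 _ _ (fun r => r^-1) (fun r : R => enorm (r *: v + x)) s 1 _ _
    dV (is_derive_line_enorm h)).
move=> /is_derive_eq; apply; field; by rewrite gt_eqF.
Qed.

Lemma enorm_line_gt0 x v : 0 < enorm x ->
  \forall s \near (0 : R), 0 < enorm (s *: v + x).
Proof.
move=> x0; have h : 0 < enorm (0 *: v + x) by rewrite scale0r add0r.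
have d := @ex_derive _ _ _ _ _ _ _ (is_derive_line_enorm h).
have c := differentiable_continuous ((derivable1_diffP _ _).1 d).
exact: cvgr_gt c _ h.
Qed.

Lemma dot_inj a b : (forall v, dot a v = dot b v) -> a = b :> 'rV[R]_n.
Proof. by move=> h; apply/rowP => i; have := h (delta_mx 0 i); rewrite !dot_delta. Qed.

End Lines.

Section TwoPointMaximum.
Context {R : realType} {n : nat}.
Variables (f : 'rV[R]_n -> R) (psi phi : R -> R) (kappa : R) (x y : 'rV[R]_n).
Hypotheses (cf : C2_space f)
  (dpsi : forall z, is_derive (f z) 1 psi (phi (f z)))
  (xy : 0 < enorm (x - y))
  (xy_max : forall x' y', psi (f x') - psi (f y') - enorm (x' - y')
      - kappa * dot x' x' <=
    psi (f x) - psi (f y) - enorm (x - y) - kappa * dot x x).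

Let e : 'rV[R]_n := (enorm (x - y))^-1 *: (x - y).

Let g (v w : 'rV[R]_n) (s : R) := psi (f (s *: v + x)) - psi (f (s *: w + y))
  - enorm (s *: (v - w) + (x - y)) - kappa * dot (s *: v + x) (s *: v + x).

Let dg (v w : 'rV[R]_n) (s : R) := phi (f (s *: v + x)) * dot (grad f (s *: v + x)) v
  - phi (f (s *: w + y)) * dot (grad f (s *: w + y)) w
  - dot (s *: (v - w) + (x - y)) (v - w) / enorm (s *: (v - w) + (x - y))
  - kappa * (2 * dot (s *: v + x) v).

Let g_max v w s : g v w s <= g v w 0.
Proof.
rewrite /g !scale0r !add0r.
have -> : s *: (v - w) + (x - y) = (s *: v + x) - (s *: w + y).
  by rewrite scalerBr opprD addrACA.
exact: xy_max.
Qed.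

Let dg_derive v w : \forall s \near (0 : R), is_derive (s : R) 1 (g v w) (dg v w s).
Proof.
apply: filterS (enorm_line_gt0 (v - w) xy) => s s0.
apply: is_deriveBf; last first.
  have := is_deriveMf (is_derive_cst kappa s 1) (is_derive_line_sqr x v s).
  by move=> /is_derive_eq; apply; rewrite /cst mulr0 addr0.
apply: is_deriveBf; last exact: is_derive_line_enorm.
by apply: is_deriveBf; apply: is_derive_comp1 => //;
  apply: is_derive_line; apply: is_derive_grad; case: cf.
Qed.

Lemma two_point_first_order :
  phi (f x) *: grad f x = e + (2 * kappa) *: x /\ phi (f y) *: grad f y = e.
Proof.
have H v w := @first_derivative_test _ _ _ (dg_derive v w)
  (@filterE _ (nbhs (0 : R)) (nbhs_filter _) _ (g_max v w)).
have d0 (a : 'rV[R]_n) : dot a 0 = 0 by rewrite /dot /bil trmx0 mulmx0 mxE.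
split; apply: dot_inj => v.
- have := H v 0; rewrite /dg !scale0r !add0r !d0 subr0 mulr0 subr0 => h.
  rewrite /e /dot bilDl !bilZl -!/(dot _ _) [_^-1 * _]mulrC; lra.
- have := H 0 v; rewrite /dg !scale0r !add0r !d0 !mulr0 subr0 sub0r => h.
  rewrite /e /dot !bilZl -!/(dot _ _) [_^-1 * _]mulrC.
  by move: h; rewrite [dot (x - y) (- v)]/dot bilNr -/(dot _ _) mulNr => h; lra.
Qed.

(** [x] moves by [v] and [y] by [w]; the distance contributes only the component of
    [v - w] orthogonal to [e]. *)
Lemma two_point_second_order a b v w :
  is_derive (f x) 1 phi a -> is_derive (f y) 1 phi b ->
  phi (f x) * bil (hess f x) v v + a * dot (grad f x) v ^+ 2 <=
  phi (f y) * bil (hess f y) w w + b * dot (grad f y) w ^+ 2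
  + (dot (v - w) (v - w) - dot e (v - w) ^+ 2) / enorm (x - y)
  + 2 * kappa * dot v v.
Proof.
move=> da db.
have dchain z c u : is_derive (f z) 1 phi c ->
    is_derive (0 : R) 1 (fun s : R => phi (f (s *: u + z)) * dot (grad f (s *: u + z)) u)
      (phi (f z) * bil (hess f z) u u + c * dot (grad f z) u ^+ 2).
  move=> dc; have dc0 : is_derive (f (0 *: u + z)) 1 phi c by rewrite scale0r add0r.
  have d1 : is_derive (0 : R) 1 (fun s : R => f (s *: u + z))
      (dot (grad f (0 *: u + z)) u).
    by apply: is_derive_line; apply: is_derive_grad; case: cf.
  have d2 : is_derive (0 : R) 1 (fun s : R => dot (grad f (s *: u + z)) u)
      (bil (hess f (0 *: u + z)) u u).
    exact: (is_derive_line (is_derive_grad_dot _ u u cf)).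
  have := is_deriveMf (@is_derive_comp1 _ _ phi _ _ _ _ _ dc0 d1) d2.
  by move=> /is_derive_eq; apply; rewrite !scale0r !add0r; ring.
have h : 0 < enorm (0 *: (v - w) + (x - y)) by rewrite scale0r add0r.
have := is_deriveBf (is_deriveBf (is_deriveBf (dchain x a v da) (dchain y b w db))
  (is_derive2_line_enorm h))
  (is_deriveMf (is_derive_cst kappa (0 : R) 1) (is_deriveMf (is_derive_cst (2 : R) (0 : R) 1)
    (is_derive_line_dot x v v 0))).
rewrite /cst.
move=> /(second_derivative_test (dg_derive v w))
  /(_ (@filterE _ (nbhs (0 : R)) (nbhs_filter _) _ (g_max v w))).
rewrite !scale0r !add0r.
have -> : dot e (v - w) = dot (x - y) (v - w) / enorm (x - y).
  by rewrite /e [LHS]/dot bilZl mulrC.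
by rewrite !mulr0 !addr0 => H; lra.
Qed.

End TwoPointMaximum.

(** * Comparison of the elliptic operators at the two points *)

Section OperatorComparison.
Context {R : realType} {n : nat}.

(** The zeroth order terms left over when the equation is written for
    [psi (u)]: they cancel when [|D psi (u)| = 1], as on the
    one-dimensional profile, and are otherwise controlled by the defect
    [|D psi (u)|^2 - 1]. *)
Lemma zeroth_order_bound (m w v q rho2 f' : R) :
  0 <= m -> 0 < w -> w ^+ 2 = 1 - m ^+ 2 -> 0 < v -> v ^+ 2 = 1 + q -> 0 <= q ->
  rho2 = (m / w) ^+ 2 * q ->
  `|f' / w ^+ 3 * (q / v ^+ 2) - m / w * v * f'| <= `|f'| / w * (2 * `|rho2 - 1|).
Proof.
move=> m0 w0 w2 v0 v2 q0 rhoE.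
have mq : m ^+ 2 * q = rho2 * w ^+ 2 by rewrite rhoE; field; rewrite gt_eqF.
have -> : f' / w ^+ 3 * (q / v ^+ 2) - m / w * v * f' =
    f' / w * ((rho2 - 1) / v ^+ 2 - (m * v - 1)).
  have h : q - v ^+ 2 * w ^+ 2 = w ^+ 2 * (rho2 - 1).
    by rewrite v2 w2; rewrite w2 in mq; lra.
  have -> : rho2 - 1 = (q - v ^+ 2 * w ^+ 2) / w ^+ 2.
    by rewrite h; field; rewrite gt_eqF.
  by field; rewrite !gt_eqF.
rewrite normrM normf_div (gtr0_norm w0); apply: ler_wpM2l.
  by rewrite divr_ge0// ltW.
apply: le_trans (ler_normB _ _) _; rewrite mulr_natl mulr2n; apply: lerD.
  rewrite normf_div ler_pdivrMr ?normr_gt0 ?expf_neq0 ?gt_eqF//.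
  rewrite [`|v ^+ 2|]ger0_norm ?exprn_ge0 ?(ltW v0)// v2.
  by rewrite ler_peMr// lerDl.
have h : (m * v - 1) * (m * v + 1) = w ^+ 2 * (rho2 - 1).
  have -> : (m * v - 1) * (m * v + 1) = m ^+ 2 * v ^+ 2 - 1 by ring.
  by rewrite v2 w2; rewrite w2 in mq; lra.
have mv : 0 <= m * v by rewrite mulr_ge0// ltW.
apply: le_trans (_ : `|m * v - 1| * (m * v + 1) <= _).
  by rewrite ler_peMr// lerDr.
rewrite -[m * v + 1]ger0_norm ?addr_ge0// -normrM h normrM.
rewrite ler_piMl// ger0_norm ?exprn_ge0 ?(ltW w0)// w2.
by rewrite lerBlDr lerDl exprn_ge0.
Qed.

(** [sqrt_row] was chosen so that at parallel gradients the two rows differ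
    only along the common direction [e], in which [|x - y|] is linear; gradients
    that are parallel up to [r] cost [O(|r|^2)]. *)
Lemma sum_sqrt_row_perp (e r p1 p2 : 'rV[R]_n) (c1 c2 v1 v2 : R) :
  dot e e = 1 -> 0 < v1 -> v1 ^+ 2 = 1 + dot p1 p1 -> 0 < c1 -> 0 < c2 ->
  c1 *: p1 = e + r -> c2 *: p2 = e -> 4^-1 <= dot (e + r) (e + r) ->
  \sum_k (dot (sqrt_row p1 v1 k - sqrt_row p2 v2 k)
              (sqrt_row p1 v1 k - sqrt_row p2 v2 k)
    - dot e (sqrt_row p1 v1 k - sqrt_row p2 v2 k) ^+ 2) <= 4 * dot r r.
Proof.
move=> ee v10 v1E c10 c20 h1 h2 rho.
have p1E : p1 = c1^-1 *: (e + r) by rewrite -h1 scalerA mulVf ?scale1r// gt_eqF.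
have p2E : p2 = c2^-1 *: e by rewrite -h2 scalerA mulVf ?scale1r// gt_eqF.
pose b := (v1 * (v1 + 1))^-1.
pose P := dot r r - dot e r ^+ 2.
have E k : dot (sqrt_row p1 v1 k - sqrt_row p2 v2 k)
              (sqrt_row p1 v1 k - sqrt_row p2 v2 k)
    - dot e (sqrt_row p1 v1 k - sqrt_row p2 v2 k) ^+ 2 =
    (b / c1) ^+ 2 * P * (p1 0 k * p1 0 k).
  pose s := p2 0 k / (v2 * (v2 + 1)) / c2.
  have -> : sqrt_row p1 v1 k - sqrt_row p2 v2 k =
      s *: e - (p1 0 k * b / c1) *: (e + r).
    rewrite /sqrt_row opprB addrC addrA subrK /s /b.
    by rewrite {2}p2E {2}p1E !scalerA.
  have := dotC r e; move: ee; rewrite /P /dot !bil_lin => -> ->; ring.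
rewrite (eq_bigr _ (fun k _ => E k)) -mulr_sumr -dotE.
have P4 : P <= dot r r by rewrite lerBlDr lerDl sqr_ge0.
have v11 : 1 <= v1 by move: (dot_ge0 p1) v10 v1E => h1' h2' h3'; nra.
pose q := dot p1 p1.
have rhoE : dot (e + r) (e + r) = c1 ^+ 2 * q.
  by rewrite -h1 /q /dot !bil_lin; ring.
have q0 : 0 <= q := dot_ge0 _.
have bq : b * q = (v1 - 1) / v1.
  have -> : q = v1 ^+ 2 - 1 by rewrite v1E addrC addKr.
  by rewrite /b; field; rewrite !gt_eqF//; lra.
have bq1 : 0 <= b * q <= 1.
  by rewrite bq divr_ge0 ?subr_ge0//= ?ler_pdivrMr ?mul1r ?gerBl ?ler01// ltW.
have qp : 0 < q.
  by rewrite lt_neqAle q0 andbT; apply/eqP => q00; move: rho; rewrite rhoE -q00; lra.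
have -> : (b / c1) ^+ 2 * P * q = (b * q) ^+ 2 / dot (e + r) (e + r) * P.
  by rewrite rhoE; field; rewrite !gt_eqF.
have k4 : (b * q) ^+ 2 / dot (e + r) (e + r) <= 4.
  have rp : 0 < dot (e + r) (e + r) by apply: lt_le_trans rho.
  by rewrite ler_pdivrMr//; case/andP: bq1 => b0 b1; nra.
apply: le_trans (_ : (b * q) ^+ 2 / dot (e + r) (e + r) * dot r r <= _).
  by apply: ler_wpM2l => //; rewrite divr_ge0// ?exprn_ge0// ?dot_ge0//; case/andP: bq1.
by apply: ler_wpM2r => //; exact: dot_ge0.
Qed.

End OperatorComparison.

Section FlowAtMaximum.
Context {R : realType} {n : nat}.
Variables (F : R -> R) (delta : R).
Hypotheses (delta0 : 0 < delta) (delta1 : delta < 1).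
Hypotheses (F0 : forall r, 0 <= F r) (dF : forall r : R, derivable F r 1).
Variables (f : 'rV[R]_n -> R) (cf : C2_space f).

Let phi := profile_cot F delta.

Definition flow_speed (z : 'rV[R]_n) : R :=
  slope f z * (mean_curvature f z - derive1 F (f z)).

Let zeroth z : R :=
  let w := profile_sin F delta (f z) in
  derive1 F (f z) / w ^+ 3 * (dot (grad f z) (grad f z) / slope f z ^+ 2)
  - phi (f z) * slope f z * derive1 F (f z).

Lemma sum_sqrt_row_sqr (p : 'rV[R]_n) v : 0 < v -> v ^+ 2 = 1 + dot p p ->
  \sum_k dot p (sqrt_row p v k) ^+ 2 = dot p p / v ^+ 2.
Proof.
move=> v0 v2; have := sum_sqrt_row (p^T *m p) v0 v2.
have bo a : bil (p^T *m p) a a = dot p a ^+ 2.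
  rewrite /bil !mulmxA -mulmxA (mx11_scalar (a *m p^T)) mul_scalar_mx mxE.
  by rewrite expr2 {1}dotC /dot /bil !mulmx1.
rewrite (eq_bigr _ (fun k _ => bo _)) => ->.
have -> : \tr (p^T *m p) = dot p p.
  by rewrite mxtrace_mulC /mxtrace big_ord1 /dot /bil mulmx1.
rewrite bo; have -> : dot p p = v ^+ 2 - 1 by rewrite v2 addrC addKr.
by field; rewrite gt_eqF.
Qed.

Lemma sum_sqrt_row_norm (p : 'rV[R]_n) v : 0 < v -> v ^+ 2 = 1 + dot p p ->
  \sum_k dot (sqrt_row p v k) (sqrt_row p v k) <= n%:R.
Proof.
move=> v0 v2; rewrite /dot (sum_sqrt_row _ v0 v2) mxtrace1.
by rewrite gerBl divr_ge0 ?dot_ge0// exprn_ge0// ltW.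
Qed.

(** The sum collects the second derivatives of [psi (f)] in the directions of the
    rows, which are what the second order condition bounds. *)
Let flow_speedE z : phi (f z) * flow_speed z =
  \sum_k (phi (f z) * bil (hess f z) (sqrt_row (grad f z) (slope f z) k)
                        (sqrt_row (grad f z) (slope f z) k)
    + - (derive1 F (f z) / profile_sin F delta (f z) ^+ 3)
       * dot (grad f z) (sqrt_row (grad f z) (slope f z) k) ^+ 2) + zeroth z.
Proof.
have v0 := slope_gt0 f z; have v2 := sqr_slope f z.
rewrite big_split/= -!mulr_sumr (sum_sqrt_row _ v0 v2) (sum_sqrt_row_sqr v0 v2).
rewrite /flow_speed mulrBr slope_mean_curvature// /zeroth; ring.
Qed.

Let zeroth_le z K e : `|derive1 F (f z)| <= K ->
  phi (f z) *: grad f z = e ->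
  `|zeroth z| <= K / delta * (2 * `|dot e e - 1|).
Proof.
move=> hK he; have w0 := @profile_sin_gt0 _ F _ delta0 delta1 F0 (f z).
have m0 := profile_cos_ge0 F delta (f z).
apply: le_trans (zeroth_order_bound (derive1 F (f z)) m0 w0 _ (slope_gt0 f z)
  (sqr_slope f z) (dot_ge0 _) (erefl _)) _.
  exact: sqr_profile_sin.
have -> : (profile_cos F delta (f z) / profile_sin F delta (f z)) ^+ 2 * dot (grad f z) (grad f z)
   = dot e e.
  by rewrite -he /dot !bil_lin /phi /profile_cot; ring.
apply: ler_wpM2r; first by rewrite mulr_ge0.
apply: ler_pM => //; first by rewrite invr_ge0 ltW.
by rewrite lef_pV2 ?posrE//; exact: profile_sin_ge.
Qed.

Variables (psi : R -> R) (kappa K : R) (x y : 'rV[R]_n).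
Hypotheses (dpsi : forall z, is_derive (f z) 1 psi (phi (f z)))
  (xy : 0 < enorm (x - y)) (kappa0 : 0 <= kappa)
  (hK : forall z, `|derive1 F (f z)| <= K)
  (xy_max : forall x' y', psi (f x') - psi (f y') - enorm (x' - y')
      - kappa * dot x' x' <=
    psi (f x) - psi (f y) - enorm (x - y) - kappa * dot x x).

(** The maximum principle at a maximum of the penalized two-point function:
    summing the second order conditions over the directions given by the square
    roots of the coefficient matrices reproduces both elliptic operators. *)
Lemma two_point_flow_le : enorm ((2 * kappa) *: x) <= 2^-1 ->
  phi (f x) * flow_speed x - phi (f y) * flow_speed y <=
  4 * enorm ((2 * kappa) *: x) ^+ 2 / enorm (x - y) + 2 * kappa * n%:R
  + 6 * K / delta * enorm ((2 * kappa) *: x).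
Proof.
have fin (a b p q z B1 B2 B3 : R) : a <= b + p + q -> p <= B1 -> q <= B2 ->
    z <= B3 -> a + z - b <= B1 + B2 + B3 by move=> h1 h2 h3 h4; lra.
set r := (2 * kappa) *: x; set t := enorm r => t2.
have [hx hy] := two_point_first_order cf dpsi xy xy_max.
rewrite -/r in hx; move: hx hy; set e := _^-1 *: (x - y) => hx hy.
have t0 : 0 <= t := enorm_ge0 r.
have tE : dot r r = t ^+ 2 by rewrite /t sqr_enorm.
have ee : dot e e = 1.
  rewrite /e /dot bilZl bilZr -/(dot _ _) -sqr_enorm; field.
  by rewrite gt_eqF.
have er : `|dot e r| <= t.
  have := dot_CS e r; rewrite ee mul1r tE => h.
  by rewrite -(ger0_norm t0) -ler_sqr ?nnegrE// !real_normK ?num_real.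
have rho : `|dot (e + r) (e + r) - 1| <= 3 * t.
  have -> : dot (e + r) (e + r) - 1 = 2 * dot e r + t ^+ 2.
    by have := dotC r e; move: ee tE; rewrite /dot !bil_lin => -> -> ->; ring.
  apply: le_trans (ler_normD _ _) _; rewrite normrM normr_nat.
  rewrite [`|t ^+ 2|]ger0_norm ?exprn_ge0// expr2.
  have tt : t * t <= 2^-1 * t by apply: ler_wpM2r.
  lra.
have rho4 : 4^-1 <= dot (e + r) (e + r).
  have -> : dot (e + r) (e + r) = 1 + 2 * dot e r + t ^+ 2.
    by have := dotC r e; move: ee tE; rewrite /dot !bil_lin => -> -> ->; ring.
  by move: er; rewrite ler_norml => /andP[h1 h2]; move: (sqr_ge0 (t - 2^-1)) => h3; lra.
have ph z b : phi (f z) *: grad f z = b -> 0 < dot b b -> 0 < phi (f z).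
  move=> hb b0; rewrite lt_neqAle profile_cot_ge0// andbT; apply/eqP => z0.
  by move: b0; rewrite -hb -z0 scale0r /dot /bil !mul0mx mxE ltxx.
have phx : 0 < phi (f x) by apply: (ph _ _ hx); apply: lt_le_trans rho4.
have phy : 0 < phi (f y) by apply: (ph _ _ hy); rewrite ee.
have dphi z : 0 < phi (f z) ->
    is_derive (f z) 1 phi (- (derive1 F (f z) / profile_sin F delta (f z) ^+ 3)).
  by move=> h; apply: is_derive_profile_cot => //; rewrite gt_eqF.
pose s1 := sqrt_row (grad f x) (slope f x).
pose s2 := sqrt_row (grad f y) (slope f y).
(* both sides of the second order condition in the directions [s1 k], [s2 k] *)
pose A z s (k : 'I_n) := phi (f z) * bil (hess f z) (s k) (s k)
  + - (derive1 F (f z) / profile_sin F delta (f z) ^+ 3) * dot (grad f z) (s k) ^+ 2.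
pose N k := dot (s1 k) (s1 k).
pose P k := dot (s1 k - s2 k) (s1 k - s2 k) - dot e (s1 k - s2 k) ^+ 2.
have spl (a p q : 'I_n -> R) c c' : \sum_k (a k + p k / c + c' * q k) =
    \sum_k a k + (\sum_k p k) / c + c' * \sum_k q k.
  by rewrite !big_split/= mulr_sumr mulr_suml.
have H : \sum_k A x s1 k <= \sum_k A y s2 k + (\sum_k P k) / enorm (x - y)
    + 2 * kappa * \sum_k N k.
  rewrite -(spl (A y s2) P N); apply: ler_sum => k _.
  exact: (two_point_second_order cf dpsi xy xy_max _ _ (dphi _ phx) (dphi _ phy)).
have Hp := sum_sqrt_row_perp (slope f y) ee (slope_gt0 f x) (sqr_slope f x)
  phx phy hx hy rho4.
have Hn := sum_sqrt_row_norm (slope_gt0 f x) (sqr_slope f x).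
have {}Hn : 2 * kappa * (\sum_k N k) <= 2 * kappa * n%:R.
  by apply: ler_wpM2l => //; rewrite mulr_ge0.
have {}Hp : (\sum_k P k) / enorm (x - y) <= 4 * t ^+ 2 / enorm (x - y).
  by rewrite -tE; apply: ler_wpM2r => //; rewrite invr_ge0 enorm_ge0.
have K0 : 0 <= K by apply: le_trans (hK x).
have zx : `|zeroth x| <= 6 * K / delta * t.
  apply: le_trans (zeroth_le (hK x) hx) _.
  rewrite [leRHS](_ : _ = K / delta * (2 * (3 * t))); last by field; rewrite gt_eqF.
  by apply: ler_wpM2l; [rewrite divr_ge0// ltW|rewrite ler_pM2l].
(* the spatial penalty acts on [x] only, so [|D psi (u)| = 1] exactly at [y] *)
have zy : zeroth y = 0.
  apply/eqP; rewrite -normr_le0; apply: le_trans (zeroth_le (hK y) hy) _.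
  by rewrite ee subrr normr0 !mulr0.
have -> : phi (f x) * flow_speed x = \sum_k A x s1 k + zeroth x.
  exact: flow_speedE.
have -> : phi (f y) * flow_speed y = \sum_k A y s2 k by rewrite flow_speedE zy addr0.
exact: fin H Hp Hn (le_trans (ler_norm _) zx).
Qed.

End FlowAtMaximum.

(** * Gradient bounds, slope bounds and Lipschitz bounds *)

Lemma derive_le_of_quotient (R : realType) (g : R -> R) (a b : R) :
  is_derive (0 : R) 1 g a -> (forall s, 0 < s -> g s - g 0 <= b * s) -> a <= b.
Proof.
move=> /is_derive1_caratheodory [k [gk ck <-]] gb; rewrite leNgt; apply/negP => kb.
have [e /= e0 eP] := (nbhs_ballP (0 : R) _).1 (cvgr_gt _ ck _ kb).
have e2 : 0 < e / 2 by rewrite divr_gt0.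
have := eP (e / 2); rewrite -ball_normE /= sub0r normrN gtr0_norm// => h.
have {}h : b < k (e / 2) by apply: h; lra.
by have := gb _ e2; rewrite gk subr0 ler_pM2r// leNgt h.
Qed.

Section LipschitzGradient.
Context {R : realType} {n : nat}.
Variables (f : 'rV[R]_n -> R) (psi phi : R -> R).
Hypotheses (cf : C1_space f)
  (dpsi : forall z, is_derive (f z) 1 psi (phi (f z)))
  (phi0 : forall r, 0 <= phi r).

Lemma lipschitz_of_gradient L x y :
  (forall z, phi (f z) * enorm (grad f z) <= L) ->
  psi (f x) - psi (f y) <= L * enorm (x - y).
Proof.
move=> hL.
have d z : is_derive z (x - y) (fun z => psi (f z)) (phi (f z) * dot (grad f z) (x - y)).
  by apply: is_derive_comp1 => //; exact: is_derive_grad.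
have [s _] := segment_MVT y d; rewrite subrK => ->.
apply: le_trans (_ : phi (f (s *: (x - y) + y))
    * (enorm (grad f (s *: (x - y) + y)) * enorm (x - y)) <= _).
  by apply: ler_wpM2l => //; exact: dot_le_enorm.
by rewrite mulrA; apply: ler_wpM2r => //; exact: enorm_ge0.
Qed.

(** The bound is tested in the direction of the gradient. *)
Lemma gradient_of_lipschitz z :
  (forall x y, psi (f x) - psi (f y) <= enorm (x - y)) ->
  phi (f z) * enorm (grad f z) <= 1.
Proof.
move=> hL; set v := grad f z.
have d : is_derive (0 : R) 1 (fun s : R => psi (f (s *: v + z)))
    (phi (f z) * dot v v).
  apply: (@is_derive_line _ _ (fun z => psi (f z))); rewrite scale0r add0r.
  by apply: is_derive_comp1 => //; exact: is_derive_grad.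
have := derive_le_of_quotient d (b := enorm v).
rewrite scale0r add0r => H.
have {}H : phi (f z) * dot v v <= enorm v.
  apply: H => s s0; apply: le_trans (hL _ _) _.
  rewrite addrK enormE /dot bilZl bilZr mulrA sqrtrM ?sqr_ge0// -expr2 sqrtr_sqr.
  by rewrite gtr0_norm// mulrC -enormE.
have [v0|v0] := eqVneq (enorm v) 0; first by rewrite v0 mulr0.
have vp : 0 < enorm v by rewrite lt_neqAle eq_sym v0 enorm_ge0.
by rewrite -(ler_pM2r vp) mul1r -mulrA -expr2 sqr_enorm.
Qed.

End LipschitzGradient.

Section SlopeBound.
Context {R : realType} {n : nat}.
Variables (F : R -> R) (delta : R).
Hypotheses (delta0 : 0 < delta) (delta1 : delta < 1) (F0 : forall r, 0 <= F r).
Variables (f : 'rV[R]_n -> R) (z : 'rV[R]_n).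

(** [cot <= 1 / |Df|] is [cos <= 1 / sqrt (1 + |Df|^2)]: the graph of [f] is at most
    as steep as the profile at the same height. *)
Let profile_cot_le1E : (profile_cot F delta (f z) * enorm (grad f z) <= 1) =
  (profile_cos F delta (f z) * slope f z <= 1).
Proof.
have w0 := profile_sin_gt0 delta0 delta1 F0 (f z); have m0 := profile_cos_ge0 F delta (f z).
have v0 := slope_gt0 f z; have p0 := enorm_ge0 (grad f z).
rewrite /profile_cot mulrAC ler_pdivrMr// mul1r.
have nn (a b : R) : 0 <= a -> 0 <= b -> a * b \is Num.nneg.
  by move=> a0 b0; rewrite nnegrE mulr_ge0.
rewrite -ler_sqr ?nn//; last by rewrite nnegrE ltW.
rewrite -[RHS]ler_sqr ?nn// ?nnegrE ?ler01//; last exact: ltW.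
rewrite !exprMn sqr_enorm sqr_slope sqr_profile_sin// expr1n mulrDr mulr1.
by rewrite lerBrDl.
Qed.

Lemma profile_cot_gradient_le1 :
  (slope f z - 1) / slope f z <= F (f z) ->
  profile_cot F delta (f z) * enorm (grad f z) <= 1.
Proof.
have v0 := slope_gt0 f z.
rewrite profile_cot_le1E ler_pdivrMr// => h.
rewrite -ler_pdivlMr// mul1r /profile_cos ge_max invr_ge0 ltW//=.
rewrite -[leRHS]mul1r ler_pdivlMr//.
have : 0 <= delta * slope f z by rewrite mulr_ge0// ltW.
rewrite !mulrBl mul1r; move: h; lra.
Qed.

Lemma gradient_profile_cot_le1 :
  profile_cot F delta (f z) * enorm (grad f z) <= 1 ->
  (slope f z - 1) / slope f z <= F (f z) + delta.
Proof.
have v0 := slope_gt0 f z.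
rewrite profile_cot_le1E ler_pdivrMr// => h.
have : (1 - delta - F (f z)) * slope f z <= profile_cos F delta (f z) * slope f z.
  by rewrite ler_pM2r// le_max lexx orbT.
move: h; lra.
Qed.

End SlopeBound.

(** * Time derivative at a maximum *)

Section TimeDerivative.
Context {R : realType} {n : nat} (T : R).
Variables (u : 'rV[R]_n -> R -> R) (psi : R -> R).
Hypothesis (cu : continuous_slab T u).

Lemma cvg_time_slab x t : 0 <= t <= T -> u x s @[s --> within `[0, T] t^'] --> u x t.
Proof.
move=> tT; apply/cvgrPdist_lt => e e0.
have [d d0 dP] := continuous_slabP x cu tT e0.
apply/nbhs_ballP; exists d => //= s; rewrite -ball_normE /= => ts _.
by rewrite in_itv /= => sT; apply: dP => //; exact: ballxx.
Qed.

Lemma cvg_time_quotient_comp x t a : 0 <= t <= T -> time_derivable T u x t ->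
  is_derive (u x t) 1 psi a ->
  (psi (u x s) - psi (u x t)) / (s - t) @[s --> within `[0, T] t^']
    --> a * time_deriv T u x t.
Proof.
move=> tT du /is_derive1_caratheodory [k [psik ck <-]].
have -> : (fun s => (psi (u x s) - psi (u x t)) / (s - t)) =
    (fun s => k (u x s) * ((u x s - u x t) / (s - t))).
  by apply/funext => s; rewrite psik mulrA.
apply: cvgM; last exact: du.
by apply: continuous_cvg => //; exact: cvg_time_slab.
Qed.

(** The maximum may be attained at the final time, so that it can only be compared
    with earlier times, and the first order condition is an inequality. *)
Lemma time_max_ge x y t a b eta : 0 < t <= T ->
  time_derivable T u x t -> time_derivable T u y t ->
  is_derive (u x t) 1 psi a -> is_derive (u y t) 1 psi b ->
  (forall s, 0 <= s <= T -> psi (u x s) - psi (u y s) - eta * s <=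
     psi (u x t) - psi (u y t) - eta * t) ->
  eta <= a * time_deriv T u x t - b * time_deriv T u y t.
Proof.
move=> /andP[t0 tT] dx dy da db hmax; rewrite leNgt; apply/negP => hlt.
have t0T : 0 <= t <= T by rewrite tT ltW.
have FF : Filter (within `[0, T]%classic t^') by exact: within_filter.
have c := @cvgB _ _ _ _ FF _ _ _ _ (cvg_time_quotient_comp t0T dx da) (cvg_time_quotient_comp t0T dy db).
have [e /= e0 eP] := (nbhs_ballP t _).1 (cvgr_lt _ c _ hlt).
pose s := Num.max 0 (t - e / 2).
have st : s < t by rewrite gt_max t0 gtrBl divr_gt0.
have s0 : 0 <= s by rewrite le_max lexx.
have se : t - e / 2 <= s by rewrite le_max lexx orbT.
have s0T : 0 <= s <= T by rewrite s0 (le_trans (ltW st)).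
have ts : ball t e s by rewrite -ball_normE /= gtr0_norm ?subr_gt0//; lra.
have sIT : `[0, T]%classic s by rewrite /= in_itv.
have sNt : s != t by rewrite lt_eqF.
have := eP s ts sNt sIT; rewrite /= => H.
have {}H : ((psi (u x s) - psi (u x t)) - (psi (u y s) - psi (u y t))) / (s - t) < eta.
  by rewrite mulrBl.
move: H; rewrite ltr_ndivrMr ?subr_lt0// ltNge => /negP; apply.
by have := hmax s s0T; lra.
Qed.

End TimeDerivative.

(** * Existence of maxima on compact sets *)

Section MaximumOnSlab.
Context {R : realType} {n : nat} (T : R).
Variables (u : 'rV[R]_n -> R -> R) (psi : R -> R).
Hypotheses (cu : continuous_slab T u)
  (cpsi : forall x t, 0 <= t <= T -> {for u x t, continuous psi}).

Definition two_point (kappa eta : R) (x y : 'rV[R]_n) (t : R) : R :=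
  psi (u x t) - psi (u y t) - enorm (x - y) - kappa * dot x x - eta * t.

Definition cube (r : R) : set 'rV[R]_n := [set x | forall i, `|x 0 i| <= r].

Lemma cube_compact r : compact (cube r).
Proof.
have -> : cube r = [set x : 'rV[R]_n | forall i, `[- r, r]%classic (x ord0 i)].
  by apply/seteqP; split=> x /= h i; have := h i; rewrite in_itv /= ler_norml.
by apply: (@rV_compact _ _ (fun=> `[- r, r]%classic)) => _; exact: segment_compact.
Qed.

Lemma dot_self_continuous : continuous (fun x : 'rV[R]_n => dot x x).
Proof.
have -> : (fun x : 'rV[R]_n => dot x x) = \sum_i (fun x : 'rV[R]_n => x 0 i * x 0 i).
  by apply/funext => x; rewrite dotE fct_sumE.
move=> x; apply: differentiable_continuous; apply: differentiable_sum => i.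
by apply: differentiableM; exact: differentiable_coord.
Qed.

Lemma enorm_continuous : continuous (@enorm R n).
Proof.
have -> : @enorm R n = Num.sqrt \o (fun x => dot x x).
  by apply/funext => x; rewrite enormE.
move=> x; apply: continuous_comp; [exact: dot_self_continuous|exact: sqrt_continuous].
Qed.

Lemma two_point_attains_max kappa eta r : 0 <= T -> 0 <= r ->
  exists x y t, [/\ cube r x, cube r y, 0 <= t <= T &
    forall x' y' t', cube r x' -> cube r y' -> 0 <= t' <= T ->
      two_point kappa eta x' y' t' <= two_point kappa eta x y t].
Proof.
move=> T0 r0.
pose D : set (('rV[R]_n * 'rV[R]_n) * R) := (cube r `*` cube r) `*` `[0, T]%classic.
pose W (p : ('rV[R]_n * 'rV[R]_n) * R) := two_point kappa eta p.1.1 p.1.2 p.2.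
have D0 : D !=set0.
  exists ((0, 0), 0); split => /=; last by rewrite in_itv /= lexx.
  by split => i; rewrite mxE normr0.
have cD : compact D.
  apply: compact_setX; last exact: segment_compact.
  by apply: compact_setX; exact: cube_compact.
have cW : {within D, continuous W}.
  apply/subspace_continuousP => p [_ pT].
  have {}pT : 0 <= p.2 <= T by move: pT; rewrite /= in_itv.
  have FF : Filter (within D (nbhs p)) by exact: within_filter.
  have uc (g : ('rV[R]_n * 'rV[R]_n) * R -> 'rV[R]_n) : continuous g ->
      psi (u (g q) q.2) @[q --> within D (nbhs p)] --> psi (u (g p) p.2).
    move=> cg; apply: continuous_cvg; first exact: cpsi.
    suff : u (g q) q.2 @[q --> within D (nbhs p)] --> u (g p) p.2 by [].
    apply/(@cvgrPdist_lt _ _ _ (within D (nbhs p)) FF) => e e0.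
    have [d d0 dP] := continuous_slabP (g p) cu pT e0.
    have gn : \forall q \near p, ball (g p) d (g q).
      by apply: cg; exact: nbhsx_ballx.
    have tn : \forall q \near p, `|p.2 - q.2| < d.
      exact: ((cvgrPdist_lt _ _).1 (@cvg_snd _ _ _ _ _) d d0).
    have h := @filterI _ _ (nbhs_filter p) _ _ gn tn.
    suff : nbhs p (fun q => D q -> `|u (g p) p.2 - u (g q) q.2| < e) by [].
    apply: (@filterS _ _ (nbhs_filter p) _ _ _ h) => q [q1 q2] [_ qT]; exact: dP.
  have wc (g : ('rV[R]_n * 'rV[R]_n) * R -> R) : continuous g ->
    g q @[q --> within D (nbhs p)] --> g p.
    by move=> cg; apply: cvg_trans (cg p); apply: cvg_app; exact: cvg_within.
  have c1 : continuous (fun q : ('rV[R]_n * 'rV[R]_n) * R => q.1.1).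
    by move=> q; apply: (@continuous_comp _ _ _ fst fst); exact: cvg_fst.
  have c2 : continuous (fun q : ('rV[R]_n * 'rV[R]_n) * R => q.1.2).
    by move=> q; apply: (@continuous_comp _ _ _ fst snd); [exact: cvg_fst|exact: cvg_snd].
  rewrite /W /two_point; apply: cvgB; last first.
    by apply: wc => q; apply: cvgM; [exact: cvg_cst|exact: cvg_snd].
  apply: cvgB; last first.
    apply: wc => q; apply: cvgM; first exact: cvg_cst.
    exact: (continuous_comp (c1 q) (@dot_self_continuous q.1.1)).
  apply: cvgB; last first.
    apply: wc => q.
    apply: (@continuous_comp _ _ _ (fun q : ('rV[R]_n * 'rV[R]_n) * R => q.1.1 - q.1.2)
      (@enorm R n)); last exact: enorm_continuous.
    by apply: (@cvgB _ 'rV[R]_n); [exact: c1|exact: c2].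
  by apply: cvgB; apply: uc.
have [[[x y] t] /set_mem[[/= xr yr] tT] H] := compact_EVT_max D0 cD cW.
exists x, y, t; split=> //.
move=> x' y' t' x'r y'r t'T; apply: (H ((x', y'), t')); apply/mem_set.
by split=> //=; rewrite in_itv.
Qed.

End MaximumOnSlab.

(** * The two-point comparison *)

Lemma C21_C2_space (R : realType) (n : nat) (T : R) (u : 'rV[R]_n -> R -> R) t :
  C21 T u -> 0 <= t <= T -> C2_space (u^~ t).
Proof.
move=> [du _ cd1 cd2 _] tT; split=> [i|i j]; split.
- by move=> x; have [+ _ _] := du x t tT; apply.
- exact: (continuous_slab_space (cd1 i) tT).
- by move=> x; have [_ + _] := du x t tT; apply.
- exact: (continuous_slab_space (cd2 i j) tT).
Qed.

Lemma oscillation_le (R : realType) (psi phi : R -> R) (L M a b : R) :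
  0 <= L -> (forall r, - M <= r <= M -> is_derive r 1 psi (phi r)) ->
  (forall r, 0 <= phi r <= L) -> `|a| <= M -> `|b| <= M ->
  psi a - psi b <= L * (2 * M).
Proof.
move=> L0 dpsi hphi; rewrite !ler_norml => aM bM.
have key c d : - M <= c -> d <= M -> c <= d ->
    exists2 k, 0 <= k <= L & psi d - psi c = k * (d - c).
  move=> cM dM cd.
  have dr (r : R) : r \in `[c, d]%R -> is_derive r 1 psi (phi r).
    by rewrite in_itv /= => /andP[cr rd]; apply: dpsi; rewrite (le_trans cM) ?(le_trans rd).
  have dr' (r : R) : r \in `]c, d[%R -> is_derive r 1 psi (phi r).
    by rewrite in_itv /= => /andP[/ltW cr /ltW rd]; apply: dr; rewrite in_itv /= cr rd.
  have cpsi : {within `[c, d], continuous psi}.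
    apply: derivable_within_continuous => r /dr dr1.
    exact: (@ex_derive _ _ _ _ _ _ _ dr1).
  by have [r _ ->] := MVT_segment cd dr' cpsi; exists (phi r).
move: aM bM => /andP[a1 a2] /andP[b1 b2].
have [ab|/ltW ba] := leP a b.
  have [k /andP[k0 kL] E] := key a b a1 b2 ab; nra.
have [k /andP[k0 kL] E] := key b a b1 a2 ba.
rewrite E; apply: ler_pM => //; [by rewrite subr_ge0|lra].
Qed.

(** Chooses the square root of the spatial penalty, on which three smallness
    conditions are imposed at once. *)
Lemma small_parameter (R : realType) (a1 a2 a3 b1 b2 b3 : R) :
  0 <= a1 -> 0 <= a2 -> 0 <= a3 -> 0 < b1 -> 0 < b2 -> 0 < b3 ->
  exists s, [/\ 0 < s <= 1, s * a1 <= b1, s * a2 <= b2 & s * a3 < b3].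
Proof.
move=> a10 a20 a30 b10 b20 b30.
pose S := 1 + a1 / b1 + a2 / b2 + (a3 + 1) / b3.
have q1 : 0 <= a1 / b1 by rewrite divr_ge0 ?(ltW b10).
have q2 : 0 <= a2 / b2 by rewrite divr_ge0 ?(ltW b20).
have q3 : 0 <= (a3 + 1) / b3 by rewrite divr_ge0 ?(ltW b30)// addr_ge0.
have S1 : 1 <= S by rewrite /S; lra.
have S0 : 0 < S by lra.
exists S^-1; split.
- by rewrite invr_gt0 S0 invf_le1.
- rewrite mulrC ler_pdivrMr// mulrC -ler_pdivrMr// /S; lra.
- rewrite mulrC ler_pdivrMr// mulrC -ler_pdivrMr// /S; lra.
- rewrite mulrC ltr_pdivrMr// mulrC -ltr_pdivrMr//.
  have : a3 / b3 < (a3 + 1) / b3 by rewrite ltr_pM2r ?invr_gt0// ltrDl.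
  by rewrite /S => h; lra.
Qed.

(** The right-hand side of [two_point_flow_le] for the penalty [kappa = s^2]: the
    gradient of the penalty is of order [s], and so is the whole error. *)
Lemma penalty_error_le (R : realType) (s q c d delta K N tau : R) :
  0 < s <= 1 -> 0 < c <= d -> 0 <= tau -> tau <= s * q -> tau <= 2^-1 ->
  0 <= K -> 0 < delta -> 0 <= N ->
  4 * tau ^+ 2 / d + 2 * s ^+ 2 * N + 6 * K / delta * tau <=
  s * (2 * q / c + 2 * N + 6 * K * q / delta).
Proof.
move=> /andP[s0 s1] /andP[c0 cd] tau0 tauq tau2 K0 delta0 N0.
have d0 : 0 < d by apply: lt_le_trans cd.
rewrite !mulrDr; apply: lerD; first apply: lerD.
- rewrite ler_pdivrMr//; apply: le_trans (_ : 2 * tau <= _).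
    rewrite expr2 mulrA [leRHS](_ : _ = 4 * (2^-1) * tau); last by field.
    by rewrite -!mulrA ler_pM2l// [tau * tau]mulrC ler_wpM2r.
  rewrite [leRHS](_ : _ = 2 * (s * q) * (d / c)); last by field; rewrite gt_eqF.
  apply: le_trans (_ : 2 * (s * q) * 1 <= _); first by rewrite mulr1 ler_pM2l.
  apply: ler_wpM2l; first by rewrite mulr_ge0// (le_trans tau0).
  by rewrite ler_pdivlMr// mul1r.
- rewrite [leRHS](_ : _ = 2 * s * N); last by ring.
  by rewrite ler_wpM2r// ler_pM2l// expr2 ler_piMr// ltW.
- rewrite [leRHS](_ : _ = 6 * K / delta * (s * q)); last by field; rewrite gt_eqF.
  by apply: ler_wpM2l => //; rewrite divr_ge0 ?(ltW delta0)// mulr_ge0.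
Qed.

Section TwoPointComparison.
Context {R : realType} {n : nat} (T : R).
Variables (F : R -> R) (delta : R) (u : 'rV[R]_n -> R -> R) (psi : R -> R).
Variables (M C K : R).
Hypotheses (T0 : 0 < T) (delta0 : 0 < delta) (delta1 : delta < 1).
Hypotheses (F0 : forall r, 0 <= F r) (dF : forall r : R, derivable F r 1).
Hypotheses (hu : C21 T u) (hsol : classical_solution T F u).
Hypotheses (hM : forall x t, 0 <= t <= T -> `|u x t| <= M)
  (hC : forall x t, 0 <= t <= T -> enorm (grad (u^~ t) x) <= C)
  (hK : forall x t, 0 <= t <= T -> `|derive1 F (u x t)| <= K)
  (dpsi : forall r, - M <= r <= M -> is_derive r 1 psi (profile_cot F delta r)).
Hypothesis (h0 : forall x y, psi (u x 0) - psi (u y 0) <= enorm (x - y)).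

(** If the comparison failed somewhere, the two-point function, penalized in
    space and in time, would have a positive maximum at a positive time, where
    [two_point_flow_le] bounds its time derivative by a quantity that tends to
    [0] with the spatial penalty. *)
Lemma two_point_comparison x y t : 0 <= t <= T ->
  psi (u x t) - psi (u y t) <= enorm (x - y).
Proof.
move=> tT; rewrite leNgt; apply/negP => hlt.
move: T0 delta0 delta1 => T0' d0' d1'.
set L := delta^-1.
have L0 : 0 < L by rewrite invr_gt0.
have ratio r : 0 <= profile_cot F delta r <= L.
  by rewrite profile_cot_ge0//= profile_cot_le.
have T00 : (0 : R) <= 0 <= T by rewrite lexx (ltW T0).
have M0 : 0 <= M by apply: le_trans (hM 0 T00).
have K0 : 0 <= K by apply: le_trans (hK 0 T00).
have C0 : 0 <= C by apply: le_trans (hC 0 T00); exact: enorm_ge0.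
have dpsiu z s : 0 <= s <= T -> is_derive (u z s) 1 psi (profile_cot F delta (u z s)).
  by move=> sT; apply: dpsi; rewrite -ler_norml hM.
pose B := L * (2 * M).
have B0 : 0 <= B by rewrite mulr_ge0 ?(ltW L0)// mulr_ge0.
have hB x' y' s : 0 <= s <= T -> psi (u x' s) - psi (u y' s) <= B.
  by move=> sT; apply: (oscillation_le (ltW L0) dpsi ratio); exact: hM.
pose A := L * (C + 1).
have A0 : 0 < A by rewrite mulr_gt0// ltr_wpDl.
have hA x' y' s : 0 <= s <= T -> psi (u x' s) - psi (u y' s) <= A * enorm (x' - y').
  move=> sT; have [cs _] := C21_C2_space hu sT.
  apply: (lipschitz_of_gradient cs (fun z => dpsiu z s sT)) => // [r|z].
    by case/andP: (ratio r).
  apply: ler_pM; [by case/andP: (ratio (u z s))|exact: enorm_ge0| |].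
    by case/andP: (ratio (u z s)).
  by apply: le_trans (hC z sT) _; lra.
pose th := psi (u x t) - psi (u y t) - enorm (x - y).
have th0 : 0 < th by rewrite subr_gt0.
(* the penalty in time costs at most a quarter of the excess [th] *)
pose eta := th / (4 * T).
have eta0 : 0 < eta by rewrite divr_gt0// mulr_gt0.
have etaT s : 0 <= s <= T -> eta * s <= th / 4.
  move=> /andP[_ sT]; have -> : th / 4 = eta * T by rewrite /eta; field; rewrite gt_eqF.
  by rewrite ler_pM2l.
(* by the Lipschitz bound, points whose excess is at least [th / 2] are at
   distance at least [c] *)
pose c := th / (2 * A).
have c0 : 0 < c by rewrite divr_gt0// mulr_gt0.
(* [kappa |x|^2 <= B] at the maximum gives [|2 kappa x| <= s q] when [kappa = s^2] *)
pose q := 2 * (B + 1).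
have q0 : 0 < q by rewrite /q; lra.
have a30 : 0 <= 2 * q / c + 2 * n%:R + 6 * K * q / delta.
  rewrite !addr_ge0//; first by rewrite divr_ge0 ?(ltW c0)// mulr_ge0// ltW.
  by rewrite divr_ge0 ?(ltW d0')// mulr_ge0 ?(ltW q0)// mulr_ge0.
have [|||s [/andP[s0 s1] sq sx seta]] :=
  small_parameter (ltW q0) (dot_ge0 x) a30 (b1 := 2^-1) (b2 := th / 4) (b3 := eta).
- by rewrite invr_gt0.
- by rewrite divr_gt0.
- by [].
pose kappa := s ^+ 2.
have k0 : 0 < kappa by rewrite exprn_gt0.
have ks : kappa <= s by rewrite /kappa expr2 ler_piMr// ltW.
pose W := two_point u psi kappa eta.
have Wxy : th / 2 <= W x y t.
  have h1 := etaT t tT.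
  have h2 : kappa * dot x x <= th / 4.
    by apply: le_trans sx; apply: ler_wpM2r => //; exact: dot_ge0.
  by rewrite /W /two_point -/th; lra.
(* outside a large cube the two-point function is negative: either the penalty or
   [|x - y|] exceeds the oscillation [B] of [psi (u)] *)
pose r1 := B / kappa + 1.
pose r2 := r1 + B.
have r10 : 1 <= r1 by rewrite /r1 lerDr divr_ge0// ltW.
have coord_le (z : 'rV[R]_n) i : `|z 0 i| <= enorm z.
  rewrite -sqrtr_sqr enormE; apply: ler_wsqrtr; rewrite dotE (bigD1 i)//= expr2 lerDl.
  by apply: sumr_ge0 => j _; exact: sqr_ge0.
have outside x' y' t' : 0 <= t' <= T -> ~ (cube r2 x' /\ cube r2 y') ->
    W x' y' t' < th / 2.
  move=> tT' out; apply: le_lt_trans (_ : B - enorm (x' - y') - kappa * dot x' x' < _).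
    rewrite /W /two_point; have := hB x' y' t' tT'.
    have : 0 <= eta * t' by rewrite mulr_ge0 ?(ltW eta0)//; case/andP: tT'.
    by move=> h1 h2; lra.
  have [x1|nx1] := pselect (cube r1 x').
    have ny : ~ cube r2 y'.
      by move=> y2; apply: out; split=> // i; apply: le_trans (x1 i) _; rewrite lerDl.
    move: ny => /existsNP[i /negP]; rewrite -ltNge => yi.
    have h1 := coord_le (x' - y') i; rewrite !mxE in h1.
    have h2 := x1 i.
    have h3 : `|y' 0 i| <= `|x' 0 i - y' 0 i| + `|x' 0 i|.
      by rewrite -{1}[y' 0 i](subrK (x' 0 i)) distrC ler_normD.
    have h4 : 0 <= kappa * dot x' x' by rewrite mulr_ge0 ?(ltW k0)// dot_ge0.
    by rewrite /r2 in yi; lra.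
  move: nx1 => /existsNP[i /negP]; rewrite -ltNge => xi.
  have h1 := coord_le x' i.
  have h2 : r1 < dot x' x'.
    rewrite -sqr_enorm expr2; have := enorm_ge0 x'; nra.
  have h3 : B < kappa * dot x' x'.
    rewrite mulrC -ltr_pdivrMr//; apply: le_lt_trans h2; rewrite /r1; lra.
  by have := enorm_ge0 (x' - y'); lra.
have [_ cu _ _ _] := hu.
have cpsi z s' : 0 <= s' <= T -> {for u z s', continuous psi}.
  move=> sT; apply: differentiable_continuous; apply/derivable1_diffP.
  exact: (@ex_derive _ _ _ _ _ _ _ (dpsiu z s' sT)).
have r20 : 0 <= r2 by rewrite addr_ge0// (le_trans ler01).
have [X [Y [t0 [_ _ t0T maxK]]]] := two_point_attains_max cu cpsi kappa eta (ltW T0') r20.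
have inside : W x y t <= W X Y t0.
  have [[xr yr]|out] := pselect (cube r2 x /\ cube r2 y); first exact: maxK.
  by have := le_lt_trans Wxy (outside _ _ _ tT out); rewrite ltxx.
have Wmax x' y' t' : 0 <= t' <= T -> W x' y' t' <= W X Y t0.
  move=> t'T; have [[xr yr]|out] := pselect (cube r2 x' /\ cube r2 y').
    exact: maxK.
  exact: le_trans (ltW (outside _ _ _ t'T out)) (le_trans Wxy inside).
have Wth : th / 2 <= W X Y t0 := le_trans Wxy inside.
have kX0 : 0 <= kappa * dot X X by rewrite mulr_ge0 ?(ltW k0)// dot_ge0.
have et0 : 0 <= eta * t0 by rewrite mulr_ge0 ?(ltW eta0)//; case/andP: t0T.
have dXY := enorm_ge0 (X - Y).
have th2 : 0 < th / 2 by rewrite divr_gt0.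
have t0p : 0 < t0.
  rewrite lt_neqAle eq_sym; case/andP: (t0T) => -> _; rewrite andbT.
  apply/eqP => t00; move: Wth kX0; rewrite t00 /W /two_point mulr0 subr0 leNgt.
  move=> /negP + kX0; apply; apply: le_lt_trans th2.
  by rewrite -addrA -opprD lerBlDr add0r (le_trans (h0 X Y))// lerDl.
have diff_ge : th / 2 + kappa * dot X X + enorm (X - Y) <= psi (u X t0) - psi (u Y t0).
  by move: Wth; rewrite /W /two_point => h; lra.
have kXB : kappa * dot X X <= B by have := hB X Y t0 t0T => h; lra.
have cd : 0 < c <= enorm (X - Y).
  rewrite c0 /c invfM mulrA ler_pdivrMr// mulrC.
  by have := hA X Y t0 t0T => h; lra.
have cs := C21_C2_space hu t0T.
have dts : 0 < t0 <= T by rewrite t0p; case/andP: t0T.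
have [dut _ _ _ _] := hu.
have hspeed z : time_deriv T u z t0 = flow_speed F (u^~ t0) z.
  by rewrite -hsol.
have eta_le := time_max_ge cu dts (let: And3 _ _ h := dut X t0 t0T in h)
  (let: And3 _ _ h := dut Y t0 t0T in h) (dpsiu X t0 t0T) (dpsiu Y t0 t0T).
have {eta_le}eta_le : eta <= profile_cot F delta (u X t0) * flow_speed F (u^~ t0) X
    - profile_cot F delta (u Y t0) * flow_speed F (u^~ t0) Y.
  rewrite -!hspeed; apply: eta_le => s' s'T.
  by have := Wmax X Y s' s'T; rewrite /W /two_point => h; lra.
pose tau := enorm ((2 * kappa) *: X).
have tau0 : 0 <= tau := enorm_ge0 _.
have tauq : tau <= s * q.
  have sq0 : 0 <= s * q by rewrite mulr_ge0 ?(ltW s0) ?(ltW q0).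
  rewrite -ler_sqr ?nnegrE//.
  rewrite /tau sqr_enorm /dot bilZl bilZr -/(dot X X).
  rewrite [leLHS](_ : _ = 4 * kappa * (kappa * dot X X)); last by ring.
  apply: le_trans (_ : 4 * kappa * B <= _).
    by apply: ler_wpM2l => //; rewrite mulr_ge0 ?(ltW k0).
  rewrite [leRHS](_ : _ = 4 * kappa * ((B + 1) ^+ 2)); last by rewrite /kappa /q; ring.
  rewrite ler_pM2l ?mulr_gt0//.
  have -> : (B + 1) ^+ 2 = B + (B ^+ 2 + B + 1) by ring.
  by rewrite lerDl !addr_ge0// exprn_ge0.
have tau2 : tau <= 2^-1 := le_trans tauq sq.
have dp : 0 < enorm (X - Y) by case/andP: cd => c0' cd'; exact: lt_le_trans cd'.
have XYmax x' y' : psi (u x' t0) - psi (u y' t0) - enorm (x' - y')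
    - kappa * dot x' x' <=
    psi (u X t0) - psi (u Y t0) - enorm (X - Y) - kappa * dot X X.
  by have := Wmax x' y' t0 t0T; rewrite /W /two_point lerD2r.
have flow_le := two_point_flow_le delta0 delta1 F0 dF cs (fun z => dpsiu z t0 t0T)
  dp (ltW k0) (fun z => hK z t0T) XYmax tau2.
have s01 : 0 < s <= 1 by rewrite s0.
have err := penalty_error_le s01 cd tau0 tauq tau2 K0 d0' (ler0n R n).
have := le_lt_trans (le_trans eta_le (le_trans flow_le err)) seta.
by rewrite ltxx.
Qed.

End TwoPointComparison.

Theorem theorem2p1 (R : realType) (n : nat) (hn : (0 < n)%N)
  (T : R) (hT : 0 < T)
  (beta : R) (hbeta : 0 < beta)
  (F : R -> R) (hF : C2_holder_loc beta F) (hF0 : forall r : R, 0 <= F r)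
  (eps : R) (heps : 0 < eps)
  (u : 'rV[R]_n -> R -> R)
  (hu : C21 T u)
  (hu_bnd : Linfty ([set: 'rV[R]_n] `*` `]- eps, T[) u)
  (hsol : classical_solution T F u)
  (C : R)
  (hgrad : forall (x : 'rV[R]_n) (t : R), 0 <= t <= T ->
     enorm (grad (u^~ t) x) <= C)
  (h0 : forall x : 'rV[R]_n,
     (slope (u^~ 0) x - 1) / slope (u^~ 0) x <= F (u x 0)) :
  forall (x : 'rV[R]_n) (t : R), 0 < t <= T ->
    (slope (u^~ t) x - 1) / slope (u^~ t) x <= F (u x t).
Proof.
have [dFF _ _] := hF.
have dF r : derivable F r 1 by case: (dFF r).
have [_ cu _ _ _] := hu.
have [M hM] := Linfty_slab_bounded hT heps cu hu_bnd.
have T00 : (0 : R) <= 0 <= T by rewrite lexx ltW.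
have M0 : 0 <= M by apply: le_trans (hM 0 0 T00).
have [K hK] : exists K, forall r, - M <= r <= M -> `|derive1 F r| <= K.
  have cF : {within `[- M, M], continuous (fun r => `|derive1 F r|)}.
    apply: continuous_subspaceT => r; apply: continuous_comp; last exact: norm_continuous.
    apply: differentiable_continuous; apply/derivable1_diffP.
    by case: (dFF r).
  have [|c _ hc] := EVT_max _ cF; first by rewrite ge0_cp.
  by exists `|derive1 F c| => r rM; apply: hc; rewrite in_itv.
move=> x t /andP[/ltW t0 tT]; have {t0}tT : 0 <= t <= T by rewrite t0.
apply/ler_addgt0Pr => e e0.
(* where [F] vanishes its profile is constant and has no inverse; the profile of
   [F + delta] is strictly monotone with slope bounded below *)
pose delta := Num.min e 2^-1.
have delta0 : 0 < delta by rewrite lt_min e0 invr_gt0 ltr0n.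
have delta1 : delta < 1 by rewrite gt_min; apply/orP; right; rewrite invf_lt1 ?ltr0n ?ltr1n.
have [psi hpsi] := continuous_primitive (- M - 1)
  (profile_cot_continuous delta0 delta1 hF0 dF).
have dpsi r : - M <= r <= M -> is_derive r 1 psi (profile_cot F delta r).
  by move=> /andP[Mr _]; apply: hpsi; lra.
have dpsiu s : 0 <= s <= T ->
    forall z, is_derive (u z s) 1 psi (profile_cot F delta (u z s)).
  by move=> sT z; apply: dpsi; rewrite -ler_norml hM.
have ratio0 r : 0 <= profile_cot F delta r by exact: profile_cot_ge0.
have initial y z : psi (u y 0) - psi (u z 0) <= enorm (y - z).
  rewrite -[leRHS]mul1r; have [c1 _] := C21_C2_space hu T00.
  apply: (lipschitz_of_gradient c1 (dpsiu 0 T00) ratio0) => w.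
  exact: (profile_cot_gradient_le1 (f := u^~ 0) delta0 delta1 hF0 (h0 w)).
have hKu z s : 0 <= s <= T -> `|derive1 F (u z s)| <= K.
  by move=> sT; apply: hK; rewrite -ler_norml hM.
have compare y z := two_point_comparison hT delta0 delta1 hF0 dF hu hsol hM hgrad
  hKu dpsi initial y z tT.
have [ct _] := C21_C2_space hu tT.
have := gradient_of_lipschitz ct (dpsiu t tT) x compare.
move=> /(gradient_profile_cot_le1 (f := u^~ t) delta0 delta1 hF0) /le_trans; apply.
by rewrite lerD2l ge_min lexx.
Qed.
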